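(* Let $E(0,\infty)$ be a symmetric quasi-Banach function space on $(0,\infty)$ with $E(0,\infty)\subset\Lambda_{\log}(0,\infty)$. Define $$F(0,\infty)=\{x\in(L_{1,\infty}+L_\infty)(0,\infty):\ \exists\, y\in E(0,\infty),\ \mu(x)\le S\mu(y)\},$$ $$\|x\|_{F(0,\infty)}=\inf\{\|y\|_{E(0,\infty)}:\ y\in E(0,\infty),\ \mu(x)\le S\mu(y)\}.$$ Then: (i) $(F(0,\infty),\|\cdot\|_{F(0,\infty)})$ is a quasi-Banach space. (ii) Moreover, $(F(0,\infty),\|\cdot\|_{F(0,\infty)})$ is the optimal symmetric quasi-Banach range for the operator $S$ on $E(0,\infty)$; that is, $F(0,\infty)$ is a symmetric quasi-Banach function space, $S:E(0,\infty)\to F(0,\infty)$ is bounded, and $F(0,\infty)\subset G(0,\infty)$ for every symmetric quasi-Banach function space $G(0,\infty)$ such that $S:E(0,\infty)\to G(0,\infty)$ is bounded.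
   Context: $S(0,\infty)$ is the space of (classes of) measurable functions $x$ on $(0,\infty)$ with $m(\{|x|>s\})<\infty$ for some $s>0$ ($m$ Lebesgue measure); $\mu(t,x)=\inf\{s\ge0:m(\{|x|>s\})\le t\}$, $t>0$, is the decreasing rearrangement. A symmetric quasi-Banach function space on $(0,\infty)$ is a quasi-Banach space $(E,\|\cdot\|_E)$, $E\subset S(0,\infty)$, such that (1) $x\in E$, $y\in S(0,\infty)$, $|y|\le|x|$ imply $y\in E$, $\|y\|_E\le\|x\|_E$; (2) $x\in E$, $y\in S(0,\infty)$, $\mu(y)=\mu(x)$ imply $y\in E$, $\|y\|_E=\|x\|_E$. $\Lambda_{\log}(0,\infty)=\{x\in S(0,\infty):\int_0^\infty\mu(s,x)\frac{ds}{1+s}<\infty\}$; $L_{1,\infty}(0,\infty)=\{x\in S(0,\infty):\sup_{t>0}t\mu(t,x)<\infty\}$. The Calderón operator $S:\Lambda_{\log}(0,\infty)\to(L_{1,\infty}+L_\infty)(0,\infty)$ is $(Sx)(t)=\frac1t\int_0^tx(s)\,ds+\int_t^\infty x(s)\frac{ds}s$. Inequalities between functions are pointwise. *)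

(* Defs.v *)
From HB Require Import structures.
From mathcomp Require Import all_boot all_order all_algebra.
From mathcomp Require Import all_classical all_reals all_analysis.
Set Implicit Arguments.
Unset Strict Implicit.
Unset Printing Implicit Defensive.
Import Order.TTheory GRing.Theory Num.Theory.
Import numFieldNormedType.Exports.
Local Open Scope classical_set_scope.
Local Open Scope ring_scope.

(* A function on (0, oo) is represented by a function R -> R whose values
   outside `]0, +oo[ are irrelevant.  A space of classes modulo a.e. equality
   is represented by a set of functions stable under a.e. equality on
   `]0, +oo[ (field [qb_ae] below) rather than by a quotient.  Measurability is
   Borel measurability: every class of Lebesgue measurable functions contains a
   Borel one, hence the explicit [measurable_fun] hypothesis in [qb_ae]. *)
Definition halfline (R : realType) : set R := `]0, +oo[.

Definition distrib (R : realType) (x : R -> R) (s : R) : \bar R :=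
  @lebesgue_measure R (@halfline R `&` [set t | s < `|x t|]).

Definition S0 (R : realType) : set (R -> R) :=
  [set x : R -> R | measurable_fun (@halfline R) x /\
           exists2 s : R, 0 < s & (distrib x s < +oo)%E].

(* The infimum is taken in R: for t > 0 and x in [S0] the set is nonempty and
   bounded below, and [rearr] is only used for such x and t. *)
Definition rearr (R : realType) (x : R -> R) (t : R) : R :=
  inf [set s : R | 0 <= s /\ (distrib x s <= t%:E)%E].

Definition Lambda_log (R : realType) : set (R -> R) :=
  [set x : R -> R | S0 x /\
   (\int[@lebesgue_measure R]_(s in @halfline R)
       (rearr x s / (1 + s))%:E < +oo)%E].

Definition L1weak (R : realType) : set (R -> R) :=
  [set x : R -> R | S0 x /\
   (ereal_sup [set (t * rearr x t)%:E | t in @halfline R] < +oo)%E].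

Definition Linfty (R : realType) : set (R -> R) :=
  [set x : R -> R | measurable_fun (@halfline R) x /\
   exists M : R,
     {ae @lebesgue_measure R, forall t, halfline t -> `|x t| <= M}].

Definition L1weak_plus_Linfty (R : realType) : set (R -> R) :=
  [set x : R -> R | measurable_fun (@halfline R) x /\
   exists y z : R -> R, [/\ L1weak y, Linfty z &
     ae_eq (@lebesgue_measure R) (@halfline R) x (y \+ z)]].

(* Both integrals are real-valued; they converge absolutely for x in
   [Lambda_log], the domain of the operator. *)
Definition calderon (R : realType) (x : R -> R) (t : R) : R :=
  t^-1 * (\int[@lebesgue_measure R]_(s in `]0, t[) x s)
  + \int[@lebesgue_measure R]_(s in `]t, +oo[) (x s / s).

Record quasi_banach (R : realType) (E : set (R -> R)) (N : (R -> R) -> R)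
    : Prop := {
  qb_meas : forall x : R -> R, E x -> measurable_fun (@halfline R) x;
  qb_ae : forall x y : R -> R, E x -> measurable_fun (@halfline R) y ->
    ae_eq (@lebesgue_measure R) (@halfline R) y x -> E y /\ N y = N x;
  qb_0 : E (cst 0);
  qb_add : forall x y : R -> R, E x -> E y -> E (x \+ y);
  qb_scale : forall (a : R) (x : R -> R), E x -> E (a \*o x);
  qb_ge0 : forall x : R -> R, E x -> 0 <= N x;
  qb_eq0 : forall x : R -> R, E x ->
    (N x = 0 <-> ae_eq (@lebesgue_measure R) (@halfline R) x (cst 0));
  qb_normZ : forall (a : R) (x : R -> R), E x -> N (a \*o x) = `|a| * N x;
  qb_triangle : exists C : R, forall x y : R -> R, E x -> E y ->
    N (x \+ y) <= C * (N x + N y);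
  qb_complete : forall u : nat -> R -> R, (forall n, E (u n)) ->
    (forall e : R, 0 < e -> exists n0 : nat, forall m n : nat,
       (n0 <= m)%N -> (n0 <= n)%N -> N (u m \- u n) < e) ->
    exists2 x, E x & (fun n => N (u n \- x)) @ \oo --> (0 : R)
}.

Record symmetric_quasi_banach (R : realType) (E : set (R -> R))
    (N : (R -> R) -> R) : Prop := {
  sqb_quasi_banach : quasi_banach E N;
  sqb_sub : E `<=` @S0 R;
  sqb_ideal : forall x y : R -> R, E x -> S0 y ->
    {ae @lebesgue_measure R, forall t, halfline t -> `|y t| <= `|x t|} ->
    E y /\ N y <= N x;
  sqb_symm : forall x y : R -> R, E x -> S0 y ->
    (forall t : R, 0 < t -> rearr y t = rearr x t) ->
    E y /\ N y = N x
}.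

Definition bounded_operator (R : realType) (T : (R -> R) -> (R -> R))
    (E : set (R -> R)) (NE : (R -> R) -> R)
    (G : set (R -> R)) (NG : (R -> R) -> R) : Prop :=
  (forall x : R -> R, E x -> G (T x)) /\
  exists C : R, forall x : R -> R, E x -> NG (T x) <= C * NE x.

Definition majorant (R : realType) (E : set (R -> R)) (x : R -> R)
    : set (R -> R) :=
  [set y | E y /\ forall t : R, 0 < t -> rearr x t <= calderon (rearr y) t].

Definition range_space (R : realType) (E : set (R -> R)) : set (R -> R) :=
  [set x : R -> R | L1weak_plus_Linfty x /\ exists y, majorant E x y].

Definition range_norm (R : realType) (E : set (R -> R)) (NE : (R -> R) -> R)
    (x : R -> R) : R :=
  inf [set NE y | y in majorant E x].

(* Main.v *)
Require Import Defs.
From mathcomp Require Import all_boot all_order all_algebra.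
From mathcomp Require Import all_classical all_reals all_analysis.
From mathcomp Require Import measurable_realfun.
From mathcomp Require Import ring lra.
Set Implicit Arguments.
Unset Strict Implicit.
Unset Printing Implicit Defensive.
Import Order.TTheory GRing.Theory Num.Theory.
Import numFieldNormedType.Exports.
Local Open Scope classical_set_scope.
Local Open Scope ring_scope.

(** Write [mu x] for the decreasing rearrangement and [S] for the Calderon
    operator. Everything rests on four facts about [S].

    - Hardy-Littlewood: [S] is integration against the kernel [1 / max t s],
      which is nonincreasing in [s], so [S |f| <= S (mu f)]
      ([ecalderon_rearr], by layer cake). Hence dominating by [S f] with [f]
      nonnegative is as good as dominating by [S (mu f)], and
      [mu (S x) <= S (mu x)], which makes [S] bounded from [E] to [F] with
      norm at most 1 ([calderon_majorant]).
    - Dilation: [S f (c t) <= S f t / c] for [c <= 1] ([ecalderon_dilation]).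
      Since [mu (x1 + x2) (t) <= mu x1 (t / 2) + mu x2 (t / 2)], the function
      [2 (mu y1 + mu y2)] majorizes [x1 + x2] when [y1], [y2] majorize [x1],
      [x2]; this is the quasi-triangle inequality. In the same way a series of
      [x k] is majorized by the series of [2 ^ (k + 1) mu (y k)]
      ([majorant_series], [majorant_dominated]).
    - Series in [E]: if the norms of nonnegative [y k] decay geometrically, fast
      enough to absorb the quasi-triangle constant, the series converges in [E]
      to a function which dominates almost everywhere all the partial sums
      ([sqb_series]).
    - Continuity: by a gliding-hump use of that series, the inclusion of [E] in
      the logarithmic Lorentz space is continuous ([sqb_logint_continuous]).
      As [S (mu y) t] is at most [1 + 1 / t] times the logarithmic integral
      of [y], a function of zero norm in [F] vanishes ([range_norm_eq0]).

    Completeness of [F] follows: along a rapidly convergent subsequence of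
    a Cauchy sequence, the increments have majorants whose norms decay
    geometrically, so the series of the increments converges almost everywhere
    and its tails have small norm in [F] ([range_complete]).

    For optimality, if [y] majorizes [x] then [S (mu y)] belongs to every
    symmetric space [G] into which [S] maps [E]; it dominates [mu x], which is
    therefore in [G], and so is [x]. *)

(** * Distribution function and decreasing rearrangement *)

#[local] Instance ae_lebesgue_filter (R : realType) :
  Filter (nbhs (almost_everywhere (@lebesgue_measure R))).
Proof. exact: ae_filter_ringOfSetsType. Qed.

Lemma measurable_halfline (R : realType) : measurable (@halfline R).
Proof. exact: measurable_itv. Qed.
#[local] Hint Extern 0 (measurable (@halfline _)) =>
  solve [apply: measurable_halfline] : core.

Lemma halflineE (R : realType) (t : R) : halfline t = (0 < t).
Proof. by rewrite /halfline /= in_itv /= andbT. Qed.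

Lemma measurable_level (R : realType) (x : R -> R) (s : R) :
  measurable_fun (@halfline R) x ->
  measurable (@halfline R `&` [set t | s < `|x t|]).
Proof.
move=> mx.
have mnx : measurable_fun (@halfline R) (fun t => `|x t|).
  exact: measurableT_comp.
have := mnx (@measurable_halfline R) _ (measurable_itv `]s, +oo[).
rewrite (_ : _ @^-1` _ = [set t | s < `|x t|]) //.
by apply/seteqP; split => t /=; rewrite in_itv /= andbT.
Qed.
#[local] Hint Resolve measurable_level : core.

Lemma le_measure_ae (R : realType) (A B : set R) :
  measurable A -> measurable B ->
  {ae @lebesgue_measure R, forall t, A t -> B t} ->
  (@lebesgue_measure R A <= @lebesgue_measure R B)%E.
Proof.
move=> mA mB [N [mN N0 AB]].
apply: (@le_trans _ _ (@lebesgue_measure R (B `|` N))).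
  apply: le_measure; rewrite ?inE //; first exact: measurableU.
  move=> t At; have [Bt|nBt] := pselect (B t); [by left|right].
  by apply: AB => /= /(_ At).
by rewrite measureU0.
Qed.

Lemma distrib_le (R : realType) (x y : R -> R) (s : R) :
  measurable_fun (@halfline R) x -> measurable_fun (@halfline R) y ->
  {ae @lebesgue_measure R, forall t, halfline t -> `|x t| <= `|y t|} ->
  (distrib x s <= distrib y s)%E.
Proof.
move=> mx my xy; apply: le_measure_ae; [exact: measurable_level..|].
by apply: filterS xy => t /[swap] -[Ht /= sx] /(_ Ht); split => //=;
  exact: lt_le_trans sx _.
Qed.

Lemma distrib_nincr (R : realType) (x : R -> R) (s s' : R) :
  measurable_fun (@halfline R) x -> s <= s' ->
  (distrib x s' <= distrib x s)%E.
Proof.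
move=> mx ss'; apply: le_measure; rewrite ?inE; [exact: measurable_level..|].
by move=> t [Ht /= s't]; split => //=; exact: le_lt_trans s't.
Qed.

Lemma distrib_add (R : realType) (x y : R -> R) (s s' : R) :
  measurable_fun (@halfline R) x -> measurable_fun (@halfline R) y ->
  (distrib (x \+ y)%R (s + s')%R <= distrib x s + distrib y s')%E.
Proof.
move=> mx my.
apply: le_trans (measureU2 _ _ _); [|exact: measurable_level..].
apply: le_measure; rewrite ?inE.
- by apply: measurable_level; exact: measurable_funD.
- by apply: measurableU; exact: measurable_level.
- move=> t [Ht /= xy]; have [sx|xs] := ltP s `|x t|; first by left; split.
  right; split => //=; rewrite ltNge; apply/negP => ys'.
  by move: xy; rewrite ltNge (le_trans (ler_normD _ _)) // lerD.
Qed.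

(** Continuity of the measure along the levels [s + 1/(n+1)], which decrease
    to [s]. *)
Lemma distrib_right_continuous (R : realType) (x : R -> R) (s : R)
    (e : \bar R) :
  measurable_fun (@halfline R) x ->
  (forall s' : R, s < s' -> (distrib x s' <= e)%E) -> (distrib x s <= e)%E.
Proof.
move=> mx xe.
pose F n : set R := @halfline R `&` [set t | s + n.+1%:R^-1 < `|x t|].
have mF n : measurable (F n) by exact: measurable_level.
have UF : \bigcup_n F n = @halfline R `&` [set t | s < `|x t|].
  apply/seteqP; split => [t [n _ [Ht /= h]]|t [Ht /= h]].
    by split => //=; apply: lt_trans h; rewrite ltrDl invr_gt0.
  have := h; rewrite -subr_gt0 => /ltr_add_invr[n]; rewrite add0r => hn.
  by exists n => //; split => //=; rewrite -ltrBrDl.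
have cF : lebesgue_measure (F n) @[n --> \oo] --> distrib x s.
  rewrite /distrib -UF; apply: nondecreasing_cvg_mu => //.
    by apply: bigcup_measurable => n _; exact: mF.
  move=> m n mn; apply/subsetPset => t [Ht /= h]; split => //=.
  by apply: le_lt_trans h; rewrite lerD2l lef_pV2 ?posrE // ler_nat.
rewrite -(cvg_lim _ cF) //; apply: lime_le.
  by apply/cvg_ex; eexists; exact: cF.
by apply: nearW => n; apply: xe; rewrite ltrDl invr_gt0.
Qed.

(** Continuity from above: the level sets decrease to the empty set because
    [x] is finite everywhere, and one of them has finite measure. *)
Lemma S0_distrib_small (R : realType) (x : R -> R) (t : R) :
  S0 x -> 0 < t -> exists2 s : R, 0 <= s & (distrib x s <= t%:E)%E.
Proof.
move=> [mx [s0 s00 fin]] t0.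
pose F n : set R := @halfline R `&` [set t | s0 + n%:R < `|x t|].
have mF n : measurable (F n) by exact: measurable_level.
have IF : \bigcap_n F n = set0.
  apply/seteqP; split => // u Fu; have := Fu (Num.truncn `|x u|).+1 I.
  case=> _ /= h; have := truncnS_gt `|x u|.
  by rewrite ltNge (le_trans _ (ltW h)) // lerDr ltW.
have cF : lebesgue_measure (F n) @[n --> \oo] --> (0 : \bar R)%E.
  rewrite -(@measure0 _ _ _ (@lebesgue_measure R)) -IF.
  apply: nonincreasing_cvg_mu => //.
  - by rewrite /F addr0.
  - by apply: bigcap_measurable => [|n _]; [exists 0%N|exact: mF].
  - move=> m n mn; apply/subsetPset => u [Hu /= h]; split => //=.
    by apply: le_lt_trans h; rewrite lerD2l ler_nat.
have /cF : nbhs (0 : \bar R)%E [set e | (e < t%:E)%E].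
  by apply: open_ereal_lt'; rewrite lte_fin.
case=> n _ /(_ n (leqnn n)) /= /ltW le; exists (s0 + n%:R) => //.
by rewrite addr_ge0 // ltW.
Qed.

Lemma distrib_rearr (R : realType) (x : R -> R) (t : R) :
  S0 x -> 0 < t -> (distrib x (rearr x t) <= t%:E)%E.
Proof.
move=> Sx t0; have [mx _] := Sx.
have [s s0 st] := S0_distrib_small Sx t0.
apply: distrib_right_continuous => // s' rs'.
have ne : [set s : R | 0 <= s /\ (distrib x s <= t%:E)%E] !=set0 by exists s.
have [u [_ ut] us'] := inf_lt ne rs'.
exact: le_trans (distrib_nincr mx (ltW us')) ut.
Qed.

Lemma rearr_ge0 (R : realType) (x : R -> R) (t : R) : 0 <= rearr x t.
Proof.
rewrite /rearr; set A := (X in inf X).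
have [->|/set0P A0] := eqVneq A set0; first by rewrite inf0.
by apply: lb_le_inf => // s [].
Qed.

Lemma rearr_le (R : realType) (x : R -> R) (s t : R) :
  0 <= s -> (distrib x s <= t%:E)%E -> rearr x t <= s.
Proof. by move=> s0 st; apply: ge_inf => //; exists 0 => ? []. Qed.

(** The rearrangement and the distribution function are generalized inverses of
    each other, because the distribution function is right-continuous. *)
Lemma rearr_leP (R : realType) (x : R -> R) (s t : R) :
  S0 x -> 0 <= s -> 0 < t -> rearr x t <= s <-> (distrib x s <= t%:E)%E.
Proof.
move=> Sx s0 t0; split; last exact: rearr_le.
move=> rs; apply: le_trans (distrib_rearr Sx t0).
by apply: distrib_nincr => //; case: Sx.
Qed.

Lemma rearr_nincr (R : realType) (x : R -> R) (t u : R) :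
  S0 x -> 0 < t -> t <= u -> rearr x u <= rearr x t.
Proof.
move=> Sx t0 tu; apply: rearr_le; first exact: rearr_ge0.
by apply: le_trans (distrib_rearr Sx t0) _; rewrite lee_fin.
Qed.

Lemma nincr_measurable_halfline (R : realType) (f : R -> R) :
  (forall t u : R, 0 < t -> t <= u -> f u <= f t) ->
  measurable_fun (@halfline R) f.
Proof.
move=> nf; apply: (measurability (@RGenCInfty.G R)) => [|/= _ [_] [r] -> <-].
  exact: RGenCInfty.measurableE.
apply: is_interval_measurable => s t /= [].
rewrite !halflineE !in_itv /= !andbT => s0 fs [t0 ft] u /andP[su ut].
split; first by rewrite halflineE; exact: lt_le_trans su.
by rewrite in_itv /= andbT (le_trans ft) // nf // (lt_le_trans s0).
Qed.

Lemma measurable_rearr (R : realType) (x : R -> R) :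
  S0 x -> measurable_fun (@halfline R) (rearr x).
Proof.
by move=> Sx; apply: nincr_measurable_halfline => *; exact: rearr_nincr.
Qed.

Lemma measure_halfline (R : realType) :
  @lebesgue_measure R (@halfline R) = +oo%E.
Proof. by rewrite /halfline lebesgue_measure_itv /= ltry. Qed.

(** An initial segment of length [d] has measure [d], so this description shows
    that [x] and [rearr x] are equimeasurable; it also makes the level sets of
    [rearr x] extremal for nonincreasing weights. *)
Lemma level_rearr (R : realType) (x : R -> R) (s : R) : S0 x -> 0 <= s ->
  @halfline R `&` [set t | s < `|rearr x t|] =
  @halfline R `&` [set t | (t%:E < distrib x s)%E].
Proof.
move=> Sx s0; apply/seteqP; split => t [Ht /=];
  rewrite (ger0_norm (rearr_ge0 _ _)) => h; split => //=;
  move: Ht; rewrite halflineE => Ht.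
  by rewrite ltNge; apply/negP => /(rearr_leP Sx s0 Ht); rewrite leNgt h.
by rewrite ltNge; apply/negP => /(rearr_leP Sx s0 Ht); rewrite leNgt h.
Qed.

Lemma distrib_rearrE (R : realType) (x : R -> R) (s : R) :
  S0 x -> 0 <= s -> distrib (rearr x) s = distrib x s.
Proof.
move=> Sx s0; rewrite {1}/distrib level_rearr //.
have : (0 <= distrib x s)%E by exact: measure_ge0.
case: (distrib x s) => [d d0| |] //.
- rewrite (_ : _ `&` _ = `]0, d[%classic).
    rewrite lebesgue_measure_itv /= lte_fin; case: ifPn => [_|].
      by rewrite oppr0 adde0.
    rewrite -leNgt => d0'; congr EFin; apply/eqP.
    by rewrite eq_le -lee_fin d0 d0'.
  apply/seteqP; split => t /=; rewrite halflineE lte_fin in_itv /=.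
    by case=> -> ->.
  by case/andP.
- move=> _; rewrite (_ : _ `&` _ = @halfline R) ?measure_halfline //.
  by apply/seteqP; split => t /= [] // Ht; split => //; rewrite ltry.
Qed.

Lemma S0_rearr (R : realType) (x : R -> R) : S0 x -> S0 (rearr x).
Proof.
move=> Sx; split; first exact: measurable_rearr.
by case: (Sx) => _ [s s0 fin]; exists s => //; rewrite distrib_rearrE // ltW.
Qed.

Lemma eq_rearr (R : realType) (x y : R -> R) (t : R) :
  (forall s : R, 0 <= s -> distrib x s = distrib y s) -> rearr x t = rearr y t.
Proof.
move=> xy; rewrite /rearr; congr inf; apply/seteqP; split => s [s0];
  by rewrite /= ?xy // -?xy.
Qed.

Lemma rearr_idem (R : realType) (x : R -> R) (t : R) :
  S0 x -> rearr (rearr x) t = rearr x t.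
Proof. by move=> Sx; apply: eq_rearr => s s0; exact: distrib_rearrE. Qed.

Lemma rearr_mono (R : realType) (x y : R -> R) (t : R) :
  measurable_fun (@halfline R) x -> S0 y -> 0 < t ->
  {ae @lebesgue_measure R, forall t, halfline t -> `|x t| <= `|y t|} ->
  rearr x t <= rearr y t.
Proof.
move=> mx Sy t0 xy; apply: rearr_le; first exact: rearr_ge0.
by apply: le_trans (distrib_rearr Sy t0); apply: distrib_le => //; case: Sy.
Qed.

Lemma rearr_add (R : realType) (x y : R -> R) (t u : R) :
  S0 x -> S0 y -> 0 < t -> 0 < u ->
  rearr (x \+ y) (t + u) <= rearr x t + rearr y u.
Proof.
move=> Sx Sy t0 u0; apply: rearr_le; first by rewrite addr_ge0 ?rearr_ge0.
apply: (le_trans (distrib_add _ _ _ _)); [by case: Sx|by case: Sy|].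
by rewrite EFinD leeD // distrib_rearr.
Qed.

Lemma distrib_scale (R : realType) (a : R) (x : R -> R) (s : R) :
  a != 0 -> distrib (a \*o x) s = distrib x (s / `|a|).
Proof.
move=> a0; rewrite /distrib; congr lebesgue_measure.
by apply/seteqP; split => t [Ht /= h]; split => //=; move: h;
  rewrite normrM ltr_pdivrMr ?normr_gt0 // mulrC.
Qed.

Lemma rearr_scale (R : realType) (a : R) (x : R -> R) (t : R) :
  S0 x -> 0 < t -> a != 0 -> rearr (a \*o x) t <= `|a| * rearr x t.
Proof.
move=> Sx t0 a0; apply: rearr_le.
  exact: mulr_ge0 (normr_ge0 _) (rearr_ge0 _ _).
by rewrite distrib_scale // mulrAC divff ?normr_eq0 // mul1r distrib_rearr.
Qed.

Lemma rearr0 (R : realType) (t : R) : 0 < t -> rearr (cst 0) t = 0 :> R.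
Proof.
move=> t0; apply/eqP; rewrite eq_le rearr_ge0 andbT; apply: rearr_le => //.
rewrite /distrib (_ : _ `&` _ = set0) ?measure0 ?lee_fin ?ltW //.
by apply/seteqP; split => // u [_ /=]; rewrite normr0 ltxx.
Qed.

(** A nonincreasing function exceeds its value at [t] only before [t]. *)
Lemma distrib_nincr_fun (R : realType) (f : R -> R) (t : R) :
  0 < t -> (forall u : R, 0 < u -> 0 <= f u) ->
  (forall t u : R, 0 < t -> t <= u -> f u <= f t) ->
  (distrib f (f t) <= t%:E)%E.
Proof.
move=> t0 f0 nf; rewrite (_ : t%:E = @lebesgue_measure R `]0, t[%classic).
  apply: le_measure; rewrite ?inE //.
    by apply: measurable_level; exact: nincr_measurable_halfline.
  move=> u [/=]; rewrite halflineE in_itv /= => u0.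
  rewrite ger0_norm ?f0 // u0 /= => h; rewrite ltNge; apply/negP => tu.
  by move: h; rewrite ltNge nf.
by rewrite lebesgue_measure_itv /= lte_fin t0 oppr0 adde0.
Qed.

Lemma S0_nincr (R : realType) (f : R -> R) :
  (forall u : R, 0 < u -> 0 <= f u) ->
  (forall t u : R, 0 < t -> t <= u -> f u <= f t) -> S0 f.
Proof.
move=> f0 nf; have mf := nincr_measurable_halfline nf; split => //.
exists (f 1 + 1); first by rewrite ltr_wpDl ?f0.
apply: (@le_lt_trans _ _ 1%:E); last exact: ltry.
apply: le_trans (distrib_nincr_fun ltr01 f0 nf).
by apply: distrib_nincr => //; rewrite lerDl.
Qed.

Lemma S0_le (R : realType) (x y : R -> R) :
  measurable_fun (@halfline R) x -> S0 y ->
  {ae @lebesgue_measure R, forall t, halfline t -> `|x t| <= `|y t|} -> S0 x.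
Proof.
move=> mx [my [s s0 fin]] xy; split => //; exists s => //.
by apply: le_lt_trans fin; exact: distrib_le.
Qed.

Lemma S0_add (R : realType) (x y : R -> R) : S0 x -> S0 y -> S0 (x \+ y).
Proof.
move=> [mx [s s0 xs]] [my [u u0 yu]]; split; first exact: measurable_funD.
exists (s + u); first exact: addr_gt0.
by apply: (le_lt_trans (distrib_add _ _ mx my)); exact: lte_add_pinfty.
Qed.

Lemma S0_scale (R : realType) (a : R) (x : R -> R) : S0 x -> S0 (a \*o x).
Proof.
move=> [mx [s s0 xs]]; split; first exact: measurable_funM.
have [->|a0] := eqVneq a 0.
  exists s => //; rewrite /distrib (_ : _ `&` _ = set0) ?measure0 //.
  by apply/seteqP; split => // u [_ /=]; rewrite mul0r normr0 ltNge ltW.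
exists (s * `|a|); first by rewrite mulr_gt0 // normr_gt0.
by rewrite distrib_scale // -mulrA divff ?normr_eq0 // mulr1.
Qed.

(** * The kernel of the operator *)

Definition ckernel (R : realType) (t s : R) : R := (Num.max t s)^-1.

(** The operator applied to [`|f|], in the extended reals: defined and monotone
    in [f] before any convergence is known. *)
Definition ecalderon (R : realType) (f : R -> R) (t : R) : \bar R :=
  (\int[@lebesgue_measure R]_(s in @halfline R) (`|f s| * ckernel t s)%:E)%E.

Lemma ckernel_ge0 (R : realType) (t s : R) : 0 < t -> 0 <= ckernel t s.
Proof. by move=> t0; rewrite invr_ge0 le_max ltW. Qed.

Lemma ckernel_nincr (R : realType) (t s s' : R) : 0 < t -> s <= s' ->
  ckernel t s' <= ckernel t s.
Proof.
move=> t0 ss'; rewrite lef_pV2 ?posrE ?lt_max ?t0 //.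
by rewrite ge_max !le_max lexx ss' orbT.
Qed.

Lemma ckernel_nincrl (R : realType) (t t' s : R) : 0 < t -> t <= t' ->
  ckernel t' s <= ckernel t s.
Proof.
move=> t0 tt'; rewrite lef_pV2 ?posrE ?lt_max ?t0 ?(lt_le_trans t0 tt') //.
by rewrite ge_max !le_max lexx tt' orbT.
Qed.

Lemma ckernel_bound (R : realType) (t s : R) : 0 < t -> 0 < s ->
  ckernel t s <= (1 + t^-1) / (1 + s).
Proof.
move=> t0 s0; rewrite ler_pdivlMr ?addr_gt0 // mulrDr mulr1 addrC.
apply: lerD; last by rewrite lef_pV2 ?posrE ?lt_max ?t0 // le_max lexx.
by rewrite /ckernel mulrC ler_pdivrMr ?lt_max ?t0 // mul1r le_max lexx orbT.
Qed.

Lemma ckernel_dilation (R : realType) (c t s : R) : 0 < c -> c <= 1 -> 0 < t ->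
  ckernel (c * t) s <= c^-1 * ckernel t s.
Proof.
move=> c0 c1 t0; rewrite /ckernel -invfM.
rewrite lef_pV2 ?posrE ?lt_max ?mulr_gt0 ?lt_max ?t0 //.
rewrite (maxr_pMr _ _ (ltW c0)) ge_max !le_max lexx /=.
have [s0|s0] := leP 0 s; first by rewrite ler_piMl ?orbT.
by rewrite ler_pM2l // (ltW (lt_trans s0 t0)).
Qed.

Lemma measurable_ckernel (R : realType) (D : set R) (t : R) : 0 < t ->
  measurable D -> measurable_fun D (ckernel t).
Proof.
by move=> t0 mD; apply: nonincreasing_measurable => // u v; exact: ckernel_nincr.
Qed.

Lemma measurable_ckernel_mul (R : realType) (f : R -> R) (t : R) : 0 < t ->
  measurable_fun (@halfline R) f ->
  measurable_fun (@halfline R) (fun s => (`|f s| * ckernel t s)%:E).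
Proof.
move=> t0 mf; apply/measurable_EFinP; apply: measurable_funM.
  exact: measurableT_comp.
exact: measurable_ckernel.
Qed.

(** Among the sets of a given measure, the initial segment carries the largest
    integral of a nonincreasing function: a set exchanges mass located after
    its measure for mass located before. *)
Lemma integral_ckernel_le (R : realType) (A : set R) (t : R) :
  measurable A -> A `<=` @halfline R -> 0 < t ->
  (\int[@lebesgue_measure R]_(s in A) (ckernel t s)%:E <=
   \int[@lebesgue_measure R]_(s in @halfline R `&`
       [set u | (u%:E < @lebesgue_measure R A)%E]) (ckernel t s)%:E)%E.
Proof.
move=> mA AH t0.
have K0 s : (0 <= (ckernel t s)%:E)%E by rewrite lee_fin ckernel_ge0.
have mK (D : set R) : measurable D ->
    measurable_fun D (fun s => (ckernel t s)%:E).
  by move=> mD; apply/measurable_EFinP; exact: measurable_ckernel.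
have : (0 <= @lebesgue_measure R A)%E by exact: measure_ge0.
case muA : (@lebesgue_measure R A) => [a| |] // a0; last first.
  have -> : @halfline R `&` [set u : R | (u%:E < (+oo : \bar R))%E] =
      @halfline R.
    by apply/seteqP; split => [s []//|s Hs]; split => //; exact: ltry.
  by apply: ge0_subset_integral => //; apply: mK.
rewrite lee_fin in a0.
set B := _ `&` _; have BE : B = `]0, a[%classic.
  apply/seteqP; split => s; rewrite /B /= halflineE lte_fin in_itv /=.
    by case=> -> ->.
  by case/andP.
have mB : measurable B by rewrite BE.
have muB : @lebesgue_measure R B = a%:E.
  rewrite BE lebesgue_measure_itv /= lte_fin; case: ifPn => [_|].
    by rewrite oppr0 adde0.
  by rewrite -leNgt => a0'; congr EFin; apply/eqP; rewrite eq_le a0 a0'.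
have splitI (X Y : set R) : measurable X -> measurable Y ->
    (\int[@lebesgue_measure R]_(s in X) (ckernel t s)%:E =
     \int[@lebesgue_measure R]_(s in X `&` Y) (ckernel t s)%:E +
     \int[@lebesgue_measure R]_(s in X `\` Y) (ckernel t s)%:E)%E.
  move=> mX mY; rewrite -{1}(setUIDK X Y) ge0_integral_setU //.
  - exact: measurableI.
  - exact: measurableD.
  - by apply: mK; apply: measurableU; [exact: measurableI|exact: measurableD].
  - by rewrite disj_set2E; apply/eqP/seteqP; split => // s [[_ Ys] [_]].
rewrite (splitI A B) // (splitI B A) // setIC leeD2l //.
have muD : @lebesgue_measure R (A `\` B) = @lebesgue_measure R (B `\` A).
  by rewrite !measureD ?(setIC B A) //= ?muA ?muB ?ltry.
apply: (@le_trans _ _ ((ckernel t a)%:E * @lebesgue_measure R (A `\` B))%E).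
  rewrite -integral_cst //; last exact: measurableD.
  apply: ge0_le_integral => //;
    [exact: measurableD|apply: mK; exact: measurableD|].
  move=> s [As nBs]; rewrite lee_fin; apply: ckernel_nincr => //.
  rewrite leNgt; apply/negP => sa; apply: nBs; rewrite BE /= in_itv /= sa andbT.
  by rewrite -halflineE; exact: AH.
rewrite muD -integral_cst //; last exact: measurableD.
apply: ge0_le_integral => //; [exact: measurableD|by move=> s _; exact: K0|
  apply: mK; exact: measurableD|].
move=> s [+ _]; rewrite BE /= in_itv /= => /andP[_ sa]; rewrite lee_fin.
by apply: ckernel_nincr => //; exact: ltW.
Qed.

(** * The Hardy-Littlewood inequality for the kernel *)

(** The product-space form of the layer-cake formula: integrating this function
    in the second variable gives [`|f s| * ckernel t s], integrating it in the
    first one at [u >= 0] gives the integral of the kernel over the level set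
    [u < `|f|]. *)
Definition layer (R : realType) (f : R -> R) (t : R) (p : R * R) : \bar R :=
  (if (0 <= p.2) && (p.2 < ((fun s => `|f s|) \_ (@halfline R)) p.1)
   then ckernel t p.1 else 0)%:E.

Lemma layer_ge0 (R : realType) (f : R -> R) (t : R) p : 0 < t ->
  (0 <= layer f t p)%E.
Proof. by move=> t0; rewrite lee_fin; case: ifP => // _; exact: ckernel_ge0. Qed.

Lemma measurable_layer (R : realType) (f : R -> R) (t : R) : 0 < t ->
  measurable_fun (@halfline R) f -> measurable_fun setT (layer f t).
Proof.
move=> t0 mf; have mn : measurable_fun (@halfline R) (fun s => `|f s|).
  exact: measurableT_comp.
apply/measurable_EFinP; apply: measurable_fun_ifT => //=.
- apply: measurable_and.
    by apply: measurable_fun_ler => //; exact: measurable_snd.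
  apply: measurable_fun_ltr; first exact: measurable_snd.
  apply: (measurableT_comp (f := (fun s => `|f s|) \_ (@halfline R))) => //.
  exact/(measurable_restrictT _ (@measurable_halfline R)).
- apply: (measurableT_comp (f := ckernel t)) => //.
  exact: measurable_ckernel.
Qed.

Lemma layer_integral_snd (R : realType) (f : R -> R) (t s : R) : 0 < t ->
  (\int[@lebesgue_measure R]_u layer f t (s, u))%E =
  ((fun s => (`|f s| * ckernel t s)%:E) \_ (@halfline R)) s.
Proof.
move=> t0; pose a : R := ((fun s => `|f s|) \_ (@halfline R)) s.
have a0 : 0 <= a by rewrite /a patchE; case: ifP.
have -> : (\int[@lebesgue_measure R]_u layer f t (s, u) =
    \int[@lebesgue_measure R]_(u in `[0%R, a[) (ckernel t s)%:E)%E.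
  rewrite [RHS]integral_mkcond; apply: eq_integral => u _.
  rewrite /layer /= -/a [RHS]patchE; case: ifPn => h.
    by rewrite mem_set //= in_itv.
  by rewrite memNset //= in_itv /=; exact/negP.
rewrite integral_cst //= lebesgue_measure_itv /= lte_fin.
have -> : (if (0 < a)%R then a%:E - 0%:E else 0)%E = a%:E.
  case: ifPn => [_|]; first by rewrite sube0.
  by rewrite -leNgt => a0'; congr EFin; apply/eqP; rewrite eq_le a0 a0'.
rewrite -EFinM mulrC /a !patchE; case: ifP => // _.
by rewrite mul0r.
Qed.

Lemma layer_integral_fst (R : realType) (f : R -> R) (t u : R) : 0 < t ->
  (\int[@lebesgue_measure R]_s layer f t (s, u))%E =
  if 0 <= u then
    (\int[@lebesgue_measure R]_(s in @halfline R `&` [set s | (u < `|f s|)%R])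
      (ckernel t s)%:E)%E
  else 0%E.
Proof.
move=> t0; case: ifPn => u0; last first.
  by apply: integral0_eq => s _; rewrite /layer /= (negbTE u0).
rewrite [RHS]integral_mkcond; apply: eq_integral => s _.
rewrite /layer /= u0 /= !patchE.
have [Hs|nHs] := pselect (@halfline R s).
  rewrite mem_set //; have [h|h] := ltP u `|f s|.
    by rewrite mem_set.
  by rewrite memNset // => -[_ /=]; rewrite ltNge h.
by rewrite !memNset //; [rewrite ltNge u0|case].
Qed.

Lemma ecalderonE (R : realType) (f : R -> R) (t : R) : 0 < t ->
  measurable_fun (@halfline R) f ->
  ecalderon f t = (\int[@lebesgue_measure R]_u
    \int[@lebesgue_measure R]_s layer f t (s, u))%E.
Proof.
move=> t0 mf.
rewrite -(@fubini_tonelli _ _ _ _ _ (@lebesgue_measure R) (@lebesgue_measure R)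
  (layer f t)); last 2 first.
- exact: measurable_layer.
- by move=> p; exact: layer_ge0.
rewrite /ecalderon integral_mkcond; apply: eq_integral => s _.
by rewrite layer_integral_snd.
Qed.

(** Level set by level set, [rearr x] has the same measure as [x] but its level
    sets are initial segments, which the kernel weighs most. *)
Lemma ecalderon_rearr (R : realType) (x : R -> R) (t : R) : 0 < t -> S0 x ->
  (ecalderon x t <= ecalderon (rearr x) t)%E.
Proof.
move=> t0 Sx; have [mx _] := Sx; have mr := measurable_rearr Sx.
rewrite !ecalderonE //; apply: ge0_le_integral => //.
- by move=> u _; apply: integral_ge0 => s _; exact: layer_ge0.
- apply: (@measurable_fun_fubini_tonelli_G _ _ _ (measurableTypeR R) R
    (@lebesgue_measure R) (layer x t)).
    exact: measurable_layer.
  by move=> p; exact: layer_ge0.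
- apply: (@measurable_fun_fubini_tonelli_G _ _ _ (measurableTypeR R) R
    (@lebesgue_measure R) (layer (rearr x) t)).
    exact: measurable_layer.
  by move=> p; exact: layer_ge0.
move=> u _; rewrite !layer_integral_fst //; case: ifPn => // u0.
rewrite level_rearr //; apply: integral_ckernel_le => //.
exact: measurable_level.
Qed.

(** * The operator: dilations, finiteness, measurability *)

Lemma ecalderon_ge0 (R : realType) (f : R -> R) (t : R) : 0 < t ->
  (0 <= ecalderon f t)%E.
Proof.
move=> t0; apply: integral_ge0 => s _.
by rewrite lee_fin mulr_ge0 // ckernel_ge0.
Qed.

Lemma ecalderon_le_ae (R : realType) (f g : R -> R) (t : R) : 0 < t ->
  measurable_fun (@halfline R) f -> measurable_fun (@halfline R) g ->
  {ae @lebesgue_measure R, forall t, halfline t -> `|f t| <= `|g t|} ->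
  (ecalderon f t <= ecalderon g t)%E.
Proof.
move=> t0 mf mg fg; apply: ae_ge0_le_integral => //.
- by move=> s _; rewrite lee_fin mulr_ge0 // ckernel_ge0.
- exact: measurable_ckernel_mul.
- by move=> s _; rewrite lee_fin mulr_ge0 // ckernel_ge0.
- exact: measurable_ckernel_mul.
- apply: filterS fg => s + Hs => /(_ Hs) fgs.
  by rewrite lee_fin ler_wpM2r // ckernel_ge0.
Qed.

Lemma ecalderon_add (R : realType) (f g : R -> R) (t : R) : 0 < t ->
  measurable_fun (@halfline R) f -> measurable_fun (@halfline R) g ->
  (forall s : R, 0 < s -> 0 <= f s) -> (forall s : R, 0 < s -> 0 <= g s) ->
  ecalderon (f \+ g) t = (ecalderon f t + ecalderon g t)%E.
Proof.
move=> t0 mf mg f0 g0; rewrite /ecalderon -ge0_integralD //.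
- apply: eq_integral => s; rewrite inE halflineE => s0.
  by rewrite -EFinD -mulrDl !ger0_norm ?addr_ge0 ?f0 ?g0.
- by move=> s _; rewrite lee_fin mulr_ge0 // ckernel_ge0.
- exact: measurable_ckernel_mul.
- by move=> s _; rewrite lee_fin mulr_ge0 // ckernel_ge0.
- exact: measurable_ckernel_mul.
Qed.

Lemma ecalderon_scale (R : realType) (a : R) (f : R -> R) (t : R) : 0 < t ->
  measurable_fun (@halfline R) f ->
  ecalderon (a \*o f) t = (`|a|%:E * ecalderon f t)%E.
Proof.
move=> t0 mf; rewrite /ecalderon -ge0_integralZl //.
- by apply: eq_integral => s _; rewrite -EFinM mulrA -normrM.
- exact: measurable_ckernel_mul.
- by move=> s _; rewrite lee_fin mulr_ge0 // ckernel_ge0.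
Qed.

Lemma ecalderon_nincr (R : realType) (f : R -> R) (t u : R) : 0 < t -> t <= u ->
  measurable_fun (@halfline R) f -> (ecalderon f u <= ecalderon f t)%E.
Proof.
move=> t0 tu mf; have u0 : 0 < u by exact: lt_le_trans tu.
apply: ge0_le_integral => //.
- by move=> s _; rewrite lee_fin mulr_ge0 // ckernel_ge0.
- exact: measurable_ckernel_mul.
- exact: measurable_ckernel_mul.
- by move=> s _; rewrite lee_fin ler_wpM2l // ckernel_nincrl.
Qed.

Lemma ecalderon_dilation (R : realType) (f : R -> R) (c t : R) :
  0 < c -> c <= 1 -> 0 < t -> measurable_fun (@halfline R) f ->
  (ecalderon f (c * t) <= c^-1%:E * ecalderon f t)%E.
Proof.
move=> c0 c1 t0 mf; have ct0 : 0 < c * t by exact: mulr_gt0.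
rewrite -ge0_integralZl //; first last.
- by rewrite lee_fin invr_ge0 ltW.
- by move=> s _; rewrite lee_fin mulr_ge0 // ckernel_ge0.
- exact: measurable_ckernel_mul.
apply: ge0_le_integral => //.
- by move=> s _; rewrite lee_fin mulr_ge0 // ckernel_ge0.
- exact: measurable_ckernel_mul.
- by apply: measurable_funeM; exact: measurable_ckernel_mul.
- by move=> s _; rewrite -EFinM lee_fin mulrCA ler_wpM2l // ckernel_dilation.
Qed.

Definition logint (R : realType) (x : R -> R) : \bar R :=
  (\int[@lebesgue_measure R]_(s in @halfline R) (rearr x s / (1 + s))%:E)%E.

Lemma logint_integrand_ge0 (R : realType) (x : R -> R) (s : R) :
  halfline s -> (0 <= (rearr x s / (1 + s))%:E)%E.
Proof.
rewrite halflineE => s0.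
by rewrite lee_fin divr_ge0 ?rearr_ge0 ?addr_ge0 // ltW.
Qed.

Lemma logint_ge0 (R : realType) (x : R -> R) : (0 <= logint x)%E.
Proof. by apply: integral_ge0 => s; exact: logint_integrand_ge0. Qed.

Lemma measurable_logint (R : realType) (x : R -> R) : S0 x ->
  measurable_fun (@halfline R) (fun s => (rearr x s / (1 + s))%:E).
Proof.
move=> Sx; apply/measurable_EFinP; apply: nincr_measurable_halfline => t u t0 tu.
have u0 : 0 < u := lt_le_trans t0 tu.
have u1 : 0 < 1 + u by rewrite addr_gt0.
apply: ler_pM; [exact: rearr_ge0|by rewrite invr_ge0 ltW|exact: rearr_nincr|].
by rewrite lef_pV2 ?posrE ?lerD2l ?addr_gt0.
Qed.

Lemma ecalderon_logint (R : realType) (x : R -> R) (t : R) : S0 x -> 0 < t ->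
  (ecalderon (rearr x) t <= (1 + t^-1)%:E * logint x)%E.
Proof.
move=> Sx t0.
rewrite /logint -ge0_integralZl //; first last.
- by rewrite lee_fin addr_ge0 // invr_ge0 ltW.
- by move=> s; exact: logint_integrand_ge0.
- exact: measurable_logint.
apply: ge0_le_integral => //.
- by move=> s _; rewrite lee_fin mulr_ge0 // ckernel_ge0.
- by apply: measurable_ckernel_mul => //; exact: measurable_rearr.
- by apply: measurable_funeM; exact: measurable_logint.
- move=> s; rewrite halflineE => s0; rewrite -EFinM lee_fin mulrCA.
  by rewrite ger0_norm ?rearr_ge0 // ler_wpM2l ?rearr_ge0 // ckernel_bound.
Qed.

Lemma ecalderon_Lambda_log (R : realType) (x : R -> R) (t : R) :
  Lambda_log x -> 0 < t -> (ecalderon (rearr x) t < +oo)%E.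
Proof.
move=> [Sx fin] t0; apply: le_lt_trans (ecalderon_logint Sx t0) _.
by rewrite lte_mul_pinfty ?lee_fin // addr_ge0 // invr_ge0 ltW.
Qed.

Lemma integrable_ckernel_mul (R : realType) (f : R -> R) (t : R) : 0 < t ->
  measurable_fun (@halfline R) f -> (ecalderon f t < +oo)%E ->
  (@lebesgue_measure R).-integrable (@halfline R)
    (EFin \o (fun s => f s * ckernel t s)).
Proof.
move=> t0 mf fin; apply/integrableP; split.
  apply/measurable_EFinP; apply: measurable_funM => //.
  exact: measurable_ckernel.
apply: le_lt_trans fin; rewrite le_eqVlt; apply/orP; left; apply/eqP.
apply: eq_integral => s _ /=.
by rewrite normrM (ger0_norm (ckernel_ge0 _ t0)).
Qed.

(** The two integrals in the definition of the operator are the parts of a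
    single integral against the kernel [1 / max t s], before and after [t]. *)
Lemma calderon_ckernel (R : realType) (f : R -> R) (t : R) : 0 < t ->
  measurable_fun (@halfline R) f -> (ecalderon f t < +oo)%E ->
  calderon f t =
    \int[@lebesgue_measure R]_(s in @halfline R) (f s * ckernel t s).
Proof.
move=> t0 mf fin; have fK := integrable_ckernel_mul t0 mf fin.
have sub1 : `]0, t[ `<=` @halfline R.
  by move=> s; rewrite halflineE /= in_itv => /andP[].
have fK1 : (@lebesgue_measure R).-integrable `]0, t[
    (EFin \o (fun s => f s * ckernel t s)) by exact: integrableS fK.
rewrite -(@subrK _ (\int[@lebesgue_measure R]_(s in `]0, t]) (f s * ckernel t s))
  (\int[@lebesgue_measure R]_(s in @halfline R) _)).
rewrite /halfline Rintegral_itvB //; last by rewrite bnd_simp ltW.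
rewrite addrC -Rintegral_itv_bndo_bndc // /calderon; congr (_ + _); last first.
  apply: eq_Rintegral => s; rewrite inE /= in_itv /= andbT => ts.
  by rewrite /ckernel max_r // ltW.
transitivity (\int[@lebesgue_measure R]_(s in `]0, t[) (t^-1 * f s)); last first.
  apply: eq_Rintegral => s; rewrite inE /= in_itv /= => /andP[s0 st].
  by rewrite /ckernel max_l ?(ltW st) // mulrC.
rewrite RintegralZl //.
rewrite (_ : EFin \o f = (fun s => t%:E * (f s / t)%:E)%E).
  apply: integrableZl => //.
  apply: eq_integrable fK1 => // s; rewrite inE /= in_itv /= => /andP[s0 st].
  by rewrite /ckernel max_l ?(ltW st).
by apply/funext => s /=; rewrite -EFinM mulrCA divff ?mulr1 // gt_eqF.
Qed.

Lemma calderon_ge0E (R : realType) (f : R -> R) (t : R) : 0 < t ->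
  measurable_fun (@halfline R) f -> (forall s : R, 0 < s -> 0 <= f s) ->
  (ecalderon f t < +oo)%E -> (calderon f t)%:E = ecalderon f t.
Proof.
move=> t0 mf f0 fin; rewrite calderon_ckernel // /Rintegral.
rewrite (_ : (\int[_]_(x in _) _)%E = ecalderon f t).
  by rewrite fineK // ge0_fin_numE // ecalderon_ge0.
by apply: eq_integral => s; rewrite inE halflineE => s0; rewrite ger0_norm ?f0.
Qed.

Lemma calderon_rearrE (R : realType) (x : R -> R) (t : R) :
  Lambda_log x -> 0 < t -> (calderon (rearr x) t)%:E = ecalderon (rearr x) t.
Proof.
move=> Lx t0; have Sx : S0 x by case: Lx.
apply: calderon_ge0E => //; first exact: measurable_rearr.
  by move=> *; exact: rearr_ge0.
exact: ecalderon_Lambda_log.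
Qed.

Lemma calderon_abs_le (R : realType) (f : R -> R) (t : R) : 0 < t ->
  measurable_fun (@halfline R) f -> (ecalderon f t < +oo)%E ->
  (`|calderon f t|%:E <= ecalderon f t)%E.
Proof.
move=> t0 mf fin; rewrite calderon_ckernel //.
have fK := integrable_ckernel_mul t0 mf fin.
rewrite EFin_normr_Rintegral //.
apply: le_trans (le_abse_integral _ _ _) _ => //; first exact: measurable_int fK.
rewrite le_eqVlt; apply/orP; left; apply/eqP; apply: eq_integral => s _ /=.
by rewrite normrM (ger0_norm (ckernel_ge0 _ t0)).
Qed.

(** The positive and the negative part of the argument contribute two
    nonincreasing functions. *)
Lemma measurable_calderon (R : realType) (f : R -> R) :
  measurable_fun (@halfline R) f ->
  (forall t : R, 0 < t -> (ecalderon f t < +oo)%E) ->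
  measurable_fun (@halfline R) (calderon f).
Proof.
move=> mf fin.
have part (g : R -> R) : measurable_fun (@halfline R) g ->
    (forall s, `|g s| <= `|f s|) ->
    (forall s, 0 <= g s) ->
    [/\ forall t : R, 0 < t -> (ecalderon g t < +oo)%E &
      measurable_fun (@halfline R) (calderon g)].
  move=> mg gf g0.
  have ging t : 0 < t -> (ecalderon g t < +oo)%E.
    move=> t0; apply: le_lt_trans (fin t t0); apply: ecalderon_le_ae => //.
    exact: aeW.
  split => //; apply: nincr_measurable_halfline => t u t0 tu.
  have u0 := lt_le_trans t0 tu.
  rewrite -lee_fin !calderon_ge0E ?ging //.
  exact: ecalderon_nincr.
have [finp mp] : [/\ forall t : R, 0 < t -> (ecalderon f^\+%R t < +oo)%E &
      measurable_fun (@halfline R) (calderon f^\+)].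
  apply: part; [exact: measurable_funrpos|move=> s|by move=> s; exact: funrpos_ge0].
  by rewrite ger0_norm ?funrpos_ge0 // /funrpos ge_max ler_norm normr_ge0.
have [finn mn] : [/\ forall t : R, 0 < t -> (ecalderon f^\-%R t < +oo)%E &
      measurable_fun (@halfline R) (calderon f^\-)].
  apply: part; [exact: measurable_funrneg|move=> s|by move=> s; exact: funrneg_ge0].
  by rewrite ger0_norm ?funrneg_ge0 // /funrneg ge_max -normrN ler_norm normr_ge0.
apply: (eq_measurable_fun (calderon f^\+ \- calderon f^\-)).
  move=> t; rewrite inE halflineE => t0 /=.
  rewrite !calderon_ckernel ?finp ?finn ?fin //;
    [|exact: measurable_funrneg|exact: measurable_funrpos].
  rewrite -RintegralB //; last 2 first.
  - by apply: integrable_ckernel_mul; rewrite ?finp //; exact: measurable_funrpos.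
  - by apply: integrable_ckernel_mul; rewrite ?finn //; exact: measurable_funrneg.
  apply: eq_Rintegral => s _; rewrite -mulrBl; congr (_ * _).
  by rewrite -[in RHS](funrposBneg f).
exact: measurable_funB.
Qed.

(** * Series and the logarithmic integral in symmetric spaces *)

Lemma rearr_scaleE (R : realType) (a : R) (x : R -> R) (t : R) :
  S0 x -> 0 < t -> rearr (a \*o x) t = `|a| * rearr x t.
Proof.
move=> Sx t0; have [->|a0] := eqVneq a 0.
  rewrite normr0 mul0r (_ : _ \*o _ = cst 0) ?rearr0 //.
  by apply/funext => s /=; rewrite mul0r.
apply/eqP; rewrite eq_le rearr_scale //= -ler_pdivlMl ?normr_gt0 //.
rewrite -normfV {1}(_ : x = a^-1 \*o (a \*o x)).
  by apply: rearr_scale; rewrite ?invr_neq0 //; exact: S0_scale.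
by apply/funext => s /=; rewrite mulKf.
Qed.

Lemma sqb_rearr (R : realType) (E : set (R -> R)) (NE : (R -> R) -> R)
    (x : R -> R) :
  symmetric_quasi_banach E NE -> E x -> E (rearr x) /\ NE (rearr x) = NE x.
Proof.
move=> hE Ex; have Sx := sqb_sub hE Ex.
by apply: sqb_symm => //; [exact: S0_rearr|move=> t _; exact: rearr_idem].
Qed.

Lemma qb_sub (R : realType) (E : set (R -> R)) (NE : (R -> R) -> R)
    (x y : R -> R) : quasi_banach E NE -> E x -> E y -> E (x \- y).
Proof.
move=> hE Ex Ey; rewrite (_ : x \- y = x \+ (-1 \*o y)).
  by apply: (qb_add hE) => //; exact: (qb_scale hE).
by apply/funext => t /=; rewrite mulN1r.
Qed.

Lemma qb_normB (R : realType) (E : set (R -> R)) (NE : (R -> R) -> R)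
    (x y : R -> R) : quasi_banach E NE -> E x -> E y ->
  NE (x \- y) = NE (y \- x).
Proof.
move=> hE Ex Ey; rewrite (_ : x \- y = -1 \*o (y \- x)).
  by rewrite (qb_normZ hE) ?normrN1 ?mul1r //; exact: qb_sub hE _ _.
by apply/funext => t /=; rewrite mulN1r opprB.
Qed.

Lemma qb_triangle_ge1 (R : realType) (E : set (R -> R)) (NE : (R -> R) -> R) :
  quasi_banach E NE -> exists2 C : R, 1 <= C &
    forall x y : R -> R, E x -> E y -> NE (x \+ y) <= C * (NE x + NE y).
Proof.
move=> hE; have [C hC] := qb_triangle hE.
exists (Num.max C 1); first by rewrite le_max lexx orbT.
move=> x y Ex Ey; apply: le_trans (hC x y Ex Ey) _.
by rewrite ler_wpM2r ?addr_ge0 ?(qb_ge0 hE) // le_max lexx.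
Qed.

Definition psum (R : realType) (y : nat -> R -> R) (n : nat) (t : R) : R :=
  \sum_(k < n) y k t.

Lemma psumS (R : realType) (y : nat -> R -> R) (n : nat) :
  psum y n.+1 = psum y n \+ y n.
Proof. by apply/funext => t; rewrite /psum big_ord_recr. Qed.

Lemma psumSl (R : realType) (y : nat -> R -> R) (n : nat) :
  psum y n.+1 = y 0%N \+ psum (fun k => y k.+1) n.
Proof. by apply/funext => t; rewrite /psum big_ord_recl. Qed.

Lemma psum0 (R : realType) (y : nat -> R -> R) : psum y 0 = cst 0.
Proof. by apply/funext => t; rewrite /psum big_ord0. Qed.

Lemma psumB (R : realType) (y : nat -> R -> R) (m n : nat) :
  psum y (m + n)%N \- psum y m = psum (fun k => y (m + k)%N) n.
Proof.
apply/funext => t; rewrite /psum /= big_split_ord /= addrAC subrr add0r.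
exact: eq_bigr.
Qed.

Lemma geometric_small (R : realType) (e r d : R) :
  0 <= r -> r <= 2^-1 -> 0 < d -> exists n0 : nat, forall n : nat,
    (n0 <= n)%N -> e * r ^+ n < d.
Proof.
move=> r0 r2 d0; have r1 : `|r| < 1.
  by rewrite ger0_norm // (le_lt_trans r2) // invf_lt1 ?ltr1n.
have : (fun n => e * r ^+ n) @ \oo --> e * 0.
  by apply: cvgM; [exact: cvg_cst|exact: cvg_expr].
rewrite mulr0 => /cvgrPdist_lt /(_ d d0)[n0 _ hn]; exists n0 => n n0n.
have := hn n n0n; rewrite /= sub0r normrN; apply: le_lt_trans.
exact: ler_norm.
Qed.

(** The factor [2 C] absorbs one application of the quasi-triangle inequality
    at each term, peeling the sum off from its first term. *)
Lemma qb_psum_le (R : realType) (E : set (R -> R)) (NE : (R -> R) -> R)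
    (C : R) :
  quasi_banach E NE -> 1 <= C ->
  (forall x y : R -> R, E x -> E y -> NE (x \+ y) <= C * (NE x + NE y)) ->
  forall (n : nat) (y : nat -> R -> R) (e : R), 0 <= e -> (forall k, E (y k)) ->
  (forall k, NE (y k) <= e * (2 * C)^-1 ^+ k.+1) ->
  E (psum y n) /\ NE (psum y n) <= e.
Proof.
move=> hE C1 hC; have C0 : 0 < C by exact: lt_le_trans C1.
have N0 : NE (cst 0) = 0.
  by apply/(qb_eq0 hE); [exact: (qb_0 hE)|exact: ae_eq_refl].
elim=> [|n ih] y e e0 Ey Ny.
  by rewrite psum0; split; [exact: (qb_0 hE)|rewrite N0].
have C20 : 0 < 2 * C by rewrite mulr_gt0.
have [] := ih (fun k => y k.+1) (e * (2 * C)^-1).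
- by rewrite mulr_ge0 // invr_ge0 ltW.
- by move=> k; exact: Ey.
- by move=> k; rewrite -mulrA -exprS; exact: Ny.
move=> Es Ns; rewrite psumSl; split; first exact: (qb_add hE).
apply: le_trans (hC _ _ (Ey 0%N) Es) _.
have := lerD (Ny 0%N) Ns; rewrite expr1 => h.
apply: le_trans (ler_wpM2l (ltW C0) h) _.
by rewrite le_eqVlt; apply/orP; left; apply/eqP; field; rewrite gt_eqF.
Qed.

(** The space is complete, so the series converges in the space; being
    a lattice, the space lets the limit inherit the order: the positive part of
    [psum y k - z] is dominated by [psum y n - z] for every later [n], hence
    has norm zero. *)
Lemma sqb_series (R : realType) (E : set (R -> R)) (NE : (R -> R) -> R)
    (C : R) :
  symmetric_quasi_banach E NE -> 1 <= C ->
  (forall x y : R -> R, E x -> E y -> NE (x \+ y) <= C * (NE x + NE y)) ->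
  forall (y : nat -> R -> R) (e : R), 0 <= e -> (forall k, E (y k)) ->
  (forall k (s : R), 0 < s -> 0 <= y k s) ->
  (forall k, NE (y k) <= e * (2 * C)^-1 ^+ k.+1) ->
  exists z : R -> R, [/\ E z, NE z <= C * e & forall n,
    {ae @lebesgue_measure R, forall s, halfline s -> psum y n s <= z s}].
Proof.
move=> hE C1 hC y e e0 Ey y0 Ny; have qE := sqb_quasi_banach hE.
have C0 : 0 < C by exact: lt_le_trans C1.
pose r := (2 * C)^-1.
have C20 : 0 < 2 * C by rewrite mulr_gt0.
have r0 : 0 <= r by rewrite invr_ge0 ltW.
have r2 : r <= 2^-1 by rewrite /r lef_pV2 ?posrE // ler_peMr.
have Es n : E (psum y n) by have [] := qb_psum_le qE C1 hC n e0 Ey Ny.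
have tail m n : (m <= n)%N -> NE (psum y n \- psum y m) <= e * r ^+ m.
  move=> mn; rewrite -(subnKC mn) psumB.
  have [] // := @qb_psum_le _ _ _ _ qE C1 hC (n - m) (fun k => y (m + k)%N)
    (e * r ^+ m).
    by rewrite mulr_ge0 // exprn_ge0.
  by move=> k; rewrite -mulrA -exprD addnS; exact: Ny.
have [z Ez cz] : exists2 z, E z & NE (psum y n \- z) @[n --> \oo] --> (0 : R).
  apply: (qb_complete qE) => // d d0.
  have [n0 hn0] := geometric_small e r0 r2 d0; exists n0 => m n n0m n0n.
  have [mn|/ltnW nm] := leqP m n.
    by rewrite (qb_normB qE) //; apply: le_lt_trans (tail _ _ mn) (hn0 _ n0m).
  by apply: le_lt_trans (tail _ _ nm) (hn0 _ n0n).
exists z; split => //.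
- apply/ler_addgt0Pr => d d0.
  have dC : 0 < d / C by rewrite divr_gt0.
  move/cvgrPdist_lt : cz => /(_ _ dC)[n0 _ /(_ n0 (leqnn n0))] /=.
  rewrite sub0r normrN => hn.
  have -> : z = (z \- psum y n0) \+ psum y n0.
    by apply/funext => s /=; rewrite subrK.
  apply: le_trans (hC _ _ _ _) _ => //; first exact: qb_sub qE _ _.
  rewrite (_ : C * e + d = C * (d / C + e)); last by field; rewrite gt_eqF.
  rewrite ler_wpM2l ?(ltW C0) // lerD //; last first.
    by have [] := qb_psum_le qE C1 hC n0 e0 Ey Ny.
  by rewrite (qb_normB qE) // (le_trans (ler_norm _)) // ltW.
- move=> k.
  pose w s := Num.max (psum y k s - z s) 0.
  have w_le n : (k <= n)%N -> E w /\ NE w <= NE (psum y n \- z).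
    move=> kn; have mono s : halfline s -> `|w s| <= `|(psum y n \- z) s|.
      rewrite halflineE => s0; rewrite ger0_norm ?le_max ?lexx ?orbT //.
      rewrite /w ge_max normr_ge0 andbT (le_trans _ (ler_norm _)) //= lerD2r.
      rewrite -subr_ge0 -/((psum y n \- psum y k) s) -(subnKC kn) psumB.
      by apply: sumr_ge0 => i _; exact: y0.
    have mw : measurable_fun (@halfline R) w.
      by apply: measurable_maxr => //; apply: measurable_funB; exact: (qb_meas qE).
    have Ed := qb_sub qE (Es n) Ez.
    have ae_mono : {ae @lebesgue_measure R, forall s, halfline s ->
        `|w s| <= `|(psum y n \- z) s|} by exact: aeW.
    apply: (sqb_ideal hE) => //.
    exact: S0_le mw (sqb_sub hE Ed) ae_mono.
  have [Ew _] := w_le k (leqnn k).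
  have Nw : NE w = 0.
    apply/eqP; rewrite eq_le (qb_ge0 qE) // andbT.
    apply/ler_addgt0Pr => d d0; rewrite add0r.
    move/cvgrPdist_lt : cz => /(_ _ d0)[n0 _ /(_ (maxn n0 k))] /=.
    rewrite leq_maxl => /(_ isT); rewrite sub0r normrN => /ltW; apply: le_trans.
    by apply: le_trans (ler_norm _); have [] := w_le _ (leq_maxr n0 k).
  move/(qb_eq0 qE Ew) : Nw; apply: filterS => s + Hs => /(_ Hs) /= ws.
  by rewrite -subr_le0 -ws /w le_max lexx.
Qed.

(** If the embedding were unbounded, some functions of rapidly decreasing norm
    would have logarithmic integrals bounded below; the sum of suitable
    multiples of their rearrangements would be an element of [E] with an
    infinite logarithmic integral. *)
Lemma sqb_logint_continuous (R : realType) (E : set (R -> R))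
    (NE : (R -> R) -> R) :
  symmetric_quasi_banach E NE -> E `<=` @Lambda_log R ->
  forall e : R, 0 < e -> exists2 d : R, 0 < d &
    forall y, E y -> NE y < d -> (logint y <= e%:E)%E.
Proof.
move=> hE hlog e e0; have qE := sqb_quasi_banach hE.
have [C C1 hC] := qb_triangle_ge1 qE.
have C0 : 0 < C by exact: lt_le_trans C1.
have C20 : 0 < 2 * C by rewrite mulr_gt0.
apply: contrapT => neg.
have /choice[y hy] : forall k : nat, exists y : R -> R,
    [/\ E y, NE y < 2^-1 ^+ k * (2 * C)^-1 ^+ k.+1 & (e%:E < logint y)%E].
  move=> k; apply: contrapT => nk; apply: neg.
  exists (2^-1 ^+ k * (2 * C)^-1 ^+ k.+1).
    by rewrite mulr_gt0 // exprn_gt0 // invr_gt0.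
  move=> y Ey Ny; rewrite leNgt; apply/negP => ey; apply: nk; by exists y.
have Ey k : E (y k) by case: (hy k).
have Er k : E (rearr (y k)) by have [] := sqb_rearr hE (Ey k).
have Sy k : S0 (y k) := sqb_sub hE (Ey k).
have [z [Ez _ zge]] : exists z : R -> R, [/\ E z, NE z <= C * 1 & forall n,
    {ae @lebesgue_measure R, forall s, halfline s ->
      psum (fun k => (2 ^+ k) \*o rearr (y k)) n s <= z s}].
  apply: (sqb_series hE C1 hC) => //.
  - by move=> k; exact: (qb_scale qE).
  - by move=> k s s0 /=; rewrite mulr_ge0 ?rearr_ge0 // exprn_ge0.
  - move=> k; rewrite mul1r (qb_normZ qE) // ger0_norm ?exprn_ge0 //.
    have [_ ->] := sqb_rearr hE (Ey k).
    rewrite -ler_pdivlMl ?exprn_gt0 // -exprVn ltW //.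
    by case: (hy k).
have Sz := sqb_sub hE Ez.
have [_ finz] := hlog _ Ez.
have big k : ((2 ^+ k * e)%:E <= logint z)%E.
  apply: (@le_trans _ _ ((2 ^+ k)%:E * logint (y k))%E).
    by rewrite EFinM lee_wpmul2l ?lee_fin ?exprn_ge0 // ltW //; case: (hy k).
  rewrite /logint -ge0_integralZl //; first last.
  - by move=> s; exact: logint_integrand_ge0.
  - exact: measurable_logint.
  apply: ge0_le_integral => //.
  - move=> s Hs; apply: mule_ge0; first by rewrite lee_fin exprn_ge0.
    exact: logint_integrand_ge0.
  - by apply: measurable_funeM; exact: measurable_logint.
  - exact: measurable_logint.
  - move=> s; rewrite halflineE => s0; rewrite -EFinM lee_fin mulrA.
    rewrite ler_wpM2r ?invr_ge0 ?addr_ge0 ?(ltW s0) //.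
    have <- : rearr ((2 ^+ k) \*o rearr (y k)) s = 2 ^+ k * rearr (y k) s.
      rewrite rearr_scaleE ?rearr_idem //; last exact: S0_rearr.
      by rewrite ger0_norm // exprn_ge0.
    apply: rearr_mono => //.
      by apply: (qb_meas qE); exact: (qb_scale qE).
    apply: filterS (zge k.+1) => u + Hu => /(_ Hu) zu /=.
    rewrite ger0_norm ?mulr_ge0 ?rearr_ge0 ?exprn_ge0 //.
    apply: le_trans (ler_norm _); apply: le_trans zu.
    rewrite psumS /= lerDr; apply: sumr_ge0 => i _ /=.
    by rewrite mulr_ge0 ?rearr_ge0 ?exprn_ge0.
have finz' : logint z \is a fin_num by rewrite ge0_fin_numE ?logint_ge0.
have half0 : 0 <= 2^-1 :> R by rewrite invr_ge0.
have [n /(_ n (leqnn n))] :=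
  geometric_small (fine (logint z)) half0 (lexx _) e0.
rewrite exprVn ltr_pdivrMr ?exprn_gt0 // mulrC; apply/negP; rewrite -leNgt.
by rewrite -lee_fin fineK.
Qed.

(** * Majorants of sums and series *)

Lemma majorantE (R : realType) (E : set (R -> R)) (x y : R -> R) :
  E `<=` @Lambda_log R ->
  majorant E x y <-> E y /\
    forall t : R, 0 < t -> ((rearr x t)%:E <= ecalderon (rearr y) t)%E.
Proof.
move=> hlog; split => -[Ey xy]; split => // t t0; have Ly := hlog _ Ey.
  by rewrite -calderon_rearrE // lee_fin; exact: xy.
by rewrite -lee_fin calderon_rearrE //; exact: xy.
Qed.

(** In the sum of weak [L1] and bounded functions the distribution function is
    finite somewhere. Conversely, cutting [x] at a level of finite measure leaves
    a large part supported in finite measure, for which the bound by the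
    operator gives the weak [L1] estimate. *)
Lemma range_spaceP (R : realType) (E : set (R -> R)) (x : R -> R) :
  E `<=` @S0 R -> E `<=` @Lambda_log R ->
  range_space E x <-> S0 x /\ exists y, majorant E x y.
Proof.
move=> hS hlog; split => -[Lx [y xy]]; split; [|by exists y| |by exists y].
- have [mx [u [v [[Su _] [mv [M vM]] xuv]]]] := Lx.
  split => //; have [mu [s s0 us]] := Su; exists (s + `|M|).
    by rewrite ltr_wpDr.
  apply: le_lt_trans us; apply: le_measure_ae; [exact: measurable_level..|].
  apply: filterS2 xuv vM => t xt vt [Ht /= h]; split => //=.
  move: h; rewrite xt //= => h; rewrite ltNge; apply/negP => ut.
  move: h; rewrite ltNge (le_trans (ler_normD _ _)) // lerD // (le_trans (vt Ht)) //.
  exact: ler_norm.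
- have [mx [a a0 xa]] := Lx; split => //.
  have mna : measurable_fun (@halfline R) (fun t => a < `|x t|).
    have mnx : measurable_fun (@halfline R) (fun t => `|x t|).
      exact: measurableT_comp.
    exact: measurable_fun_ltr.
  pose u t := if a < `|x t| then x t else 0.
  pose v t := if a < `|x t| then 0 else x t.
  have mu : measurable_fun (@halfline R) u.
    by apply: measurable_fun_if => //; exact: measurable_funS mx.
  have mv : measurable_fun (@halfline R) v.
    by apply: measurable_fun_if => //; exact: measurable_funS mx.
  have ux : {ae @lebesgue_measure R, forall t, halfline t -> `|u t| <= `|x t|}.
    by apply: aeW => t _; rewrite /u; case: ifP; rewrite ?normr0.
  have Su := S0_le mu Lx ux.
  have [Ey xy'] := (majorantE x y hlog).1 xy; have [Sy finy] := hlog _ Ey.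
  have finl : logint y \is a fin_num by rewrite ge0_fin_numE ?logint_ge0.
  set L := fine (logint y); have L0 : 0 <= L by rewrite fine_ge0 ?logint_ge0.
  (* Beyond [D = distrib x a] the rearrangement of [u] vanishes, so a bound for
     [t * rearr x t] growing linearly in [t] suffices. *)
  have xL t : 0 < t -> t * rearr x t <= (t + 1) * L.
    move=> t0; have := le_trans (xy' t t0) (ecalderon_logint Sy t0).
    rewrite -(fineK finl) -EFinM lee_fin -/L => h.
    apply: le_trans (ler_wpM2l (ltW t0) h) _.
    by rewrite mulrA mulrDr mulr1 divff ?gt_eqF.
  have d0 : (0 <= distrib x a)%E by exact: measure_ge0.
  have find : distrib x a \is a fin_num by rewrite ge0_fin_numE.
  set D := fine (distrib x a); have D0 : 0 <= D by exact: fine_ge0.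
  exists u, v; split.
  + split => //; apply: (@le_lt_trans _ _ ((D + 1) * L)%:E); last exact: ltry.
    apply: ge_ereal_sup => _ [t + <-]; rewrite halflineE => t0; rewrite lee_fin.
    have [tD|Dt] := leP t D.
      apply: (@le_trans _ _ (t * rearr x t)).
        by rewrite ler_wpM2l ?(ltW t0) //; exact: rearr_mono.
      by apply: le_trans (xL t t0) _; rewrite ler_wpM2r // lerD2r.
    rewrite (_ : rearr u t = 0) ?mulr0 ?mulr_ge0 ?addr_ge0 //.
    apply/eqP; rewrite eq_le rearr_ge0 andbT; apply: rearr_le => //.
    apply: (@le_trans _ _ (distrib x a)); last by rewrite -(fineK find) lee_fin ltW.
    apply: le_measure; rewrite ?inE; [exact: measurable_level..|].
    by move=> s [Hs /=]; rewrite /u; case: ifPn => // _; rewrite normr0 ltxx.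
  + split => //; exists a; apply: aeW => t _; rewrite /v; case: ifPn.
      by rewrite normr0 ltW.
    by rewrite -leNgt.
  + by apply: aeW => t _; rewrite /u /v /=; case: ifP; rewrite ?addr0 ?add0r.
Qed.

Lemma range_norm_ge0 (R : realType) (E : set (R -> R)) (NE : (R -> R) -> R)
    (x : R -> R) : quasi_banach E NE -> 0 <= range_norm E NE x.
Proof.
move=> hE; rewrite /range_norm; set A := (X in inf X).
have [->|/set0P A0] := eqVneq A set0; first by rewrite inf0.
by apply: lb_le_inf => // _ [y [Ey _] <-]; exact: (qb_ge0 hE).
Qed.

Lemma range_norm_le (R : realType) (E : set (R -> R)) (NE : (R -> R) -> R)
    (x y : R -> R) : quasi_banach E NE -> majorant E x y ->
  range_norm E NE x <= NE y.
Proof.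
move=> hE xy; apply: ge_inf; last by exists y.
by exists 0 => _ [z [Ez _] <-]; exact: (qb_ge0 hE).
Qed.

Lemma range_norm_lt (R : realType) (E : set (R -> R)) (NE : (R -> R) -> R)
    (x : R -> R) (d : R) : (exists y, majorant E x y) ->
  range_norm E NE x < d -> exists2 y, majorant E x y & NE y < d.
Proof.
move=> [y xy] xd.
have ne : [set NE y | y in majorant E x] !=set0 by exists (NE y); exists y.
by have [_ [z xz <-] zd] := inf_lt ne xd; exists z.
Qed.

(** The rearrangement of a sum is controlled by the rearrangements of the terms
    at half the argument, and halving the argument costs the operator
    a factor 2: hence the factor in the majorant. *)
Lemma majorant_add (R : realType) (E : set (R -> R)) (NE : (R -> R) -> R)
    (x1 x2 y1 y2 : R -> R) :
  symmetric_quasi_banach E NE -> E `<=` @Lambda_log R -> S0 x1 -> S0 x2 ->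
  majorant E x1 y1 -> majorant E x2 y2 ->
  majorant E (x1 \+ x2) (2 \*o (rearr y1 \+ rearr y2)).
Proof.
move=> hE hlog Sx1 Sx2 /(majorantE _ _ hlog)[Ey1 xy1].
move=> /(majorantE _ _ hlog)[Ey2 xy2]; have qE := sqb_quasi_banach hE.
have [Er1 _] := sqb_rearr hE Ey1; have [Er2 _] := sqb_rearr hE Ey2.
have m1 := qb_meas qE Er1; have m2 := qb_meas qE Er2.
have Ey : E (2 \*o (rearr y1 \+ rearr y2)).
  by apply: (qb_scale qE); exact: (qb_add qE).
apply/(majorantE _ _ hlog); split; [exact: Ey|move=> t t0].
apply: le_trans (ecalderon_rearr t0 (sqb_sub hE Ey)).
rewrite ecalderon_scale // ?ecalderon_add //; first last.
- exact: measurable_funD.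
- by move=> *; exact: rearr_ge0.
- by move=> *; exact: rearr_ge0.
have h0 : 0 < 2^-1 * t by rewrite mulr_gt0.
have hh : 2^-1 * t + 2^-1 * t = t by lra.
apply: (@le_trans _ _ ((rearr x1 (2^-1 * t))%:E + (rearr x2 (2^-1 * t))%:E)%E).
  by rewrite -EFinD lee_fin -[X in rearr _ X <= _]hh rearr_add.
have half1 : 2^-1 <= 1 :> R by lra.
have dil y : measurable_fun (@halfline R) (rearr y) ->
    (ecalderon (rearr y) (2^-1 * t) <= 2%:E * ecalderon (rearr y) t)%E.
  move=> my; have := @ecalderon_dilation R (rearr y) 2^-1 t.
  by rewrite invrK; apply.
rewrite ger0_norm // ge0_muleDr ?ecalderon_ge0 //.
by apply: leeD; [apply: le_trans (xy1 _ h0) _|apply: le_trans (xy2 _ h0) _];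
  exact: dil.
Qed.

(** The [k]-th set has measure at most [t / 2 ^ k.+1]; off their union, the
    partial sums of a series are bounded by the sum of the rearrangements of the
    terms at these arguments. *)
Lemma measure_series_level (R : realType) (x : nat -> R -> R) (t : R) :
  (forall k, S0 (x k)) -> 0 < t ->
  (@lebesgue_measure R (\bigcup_k (@halfline R `&`
    [set s | (rearr (x k) (t / (2 ^ k.+1)%:R) < `|x k s|)%R])) <= t%:E)%E.
Proof.
move=> Sx t0; set F := fun k => _.
have mF k : measurable (F k) by apply: measurable_level; case: (Sx k).
apply: le_trans (generalized_Boole_inequality _ _ _) _.
- by move=> k; exact: mF.
- by apply: bigcup_measurable => k _; exact: mF.
apply: le_trans (epsilon_trick0 xpredT (ltW t0)).
apply: lee_nneseries => [k _ _|k _]; first exact: measure_ge0.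
by apply: distrib_rearr => //; rewrite divr_gt0 // ltr0n expn_gt0.
Qed.

(** The value of [rearr (x k)] at [t / 2 ^ k.+1] is at most [2 ^ k.+1] times the
    operator at [t] on [rearr (y k)]; the ratio [4 C] leaves a ratio [2 C] after
    this loss, as the series in [E] requires. *)
Lemma majorant_series (R : realType) (E : set (R -> R)) (NE : (R -> R) -> R)
    (C : R) :
  symmetric_quasi_banach E NE -> E `<=` @Lambda_log R -> 1 <= C ->
  (forall x y : R -> R, E x -> E y -> NE (x \+ y) <= C * (NE x + NE y)) ->
  forall (x y : nat -> R -> R) (e : R), 0 <= e -> (forall k, S0 (x k)) ->
  (forall k, majorant E (x k) (y k)) ->
  (forall k, NE (y k) <= e * (4 * C)^-1 ^+ k.+1) ->
  exists z, [/\ E z, NE z <= C * e & forall n (t : R), 0 < t ->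
    ((\sum_(k < n) rearr (x k) (t / (2 ^ k.+1)%:R))%:E <=
       ecalderon (rearr z) t)%E].
Proof.
move=> hE hlog C1 hC x y e e0 Sx xy Ny; have qE := sqb_quasi_banach hE.
have C0 : 0 < C by exact: lt_le_trans C1.
pose p k : R := (2 ^ k.+1)%:R.
have p0 k : 0 < p k by rewrite ltr0n expn_gt0.
pose Y k := p k \*o rearr (y k).
have Ey k : E (y k) by case: (xy k).
have Er k : E (rearr (y k)) by have [] := sqb_rearr hE (Ey k).
have EY k : E (Y k) by exact: (qb_scale qE).
have Y0 k s : 0 <= Y k s by rewrite mulr_ge0 ?rearr_ge0 ?ltW.
have NY k : NE (Y k) <= e * (2 * C)^-1 ^+ k.+1.
  rewrite (qb_normZ qE) // gtr0_norm //; have [_ ->] := sqb_rearr hE (Ey k).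
  rewrite -ler_pdivlMl //; apply: le_trans (Ny k) _.
  rewrite le_eqVlt; apply/orP; left; apply/eqP.
  rewrite mulrCA; congr (_ * _).
  rewrite /p natrX -exprVn -exprMn; congr (_ ^+ _).
  by rewrite -invfM mulrA -natrM.
have [z [Ez Nz zge]] := sqb_series hE C1 hC e0 EY (fun k s _ => Y0 k s) NY.
exists z; split => // n t t0.
have Sz := sqb_sub hE Ez.
have mps m : measurable_fun (@halfline R) (psum Y m).
  by have [Es _] := qb_psum_le qE C1 hC m e0 EY NY; exact: (qb_meas qE).
have ps0 m s : 0 <= psum Y m s by apply: sumr_ge0.
apply: le_trans (ecalderon_rearr t0 Sz).
apply: (@le_trans _ _ (ecalderon (psum Y n) t)); last first.
  apply: ecalderon_le_ae => //; first exact: (qb_meas qE).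
  apply: filterS (zge n) => s + Hs => /(_ Hs) zs; rewrite ger0_norm //.
  exact: le_trans zs (ler_norm _).
elim: n => [|n ih]; first by rewrite big_ord0 ecalderon_ge0.
rewrite big_ord_recr /= EFinD psumS ecalderon_add //; last exact: (qb_meas qE).
apply: leeD => //.
have [_ /(_ (t / p n))] := (majorantE _ _ hlog).1 (xy n).
rewrite divr_gt0 // => /(_ isT) h; apply: le_trans h _.
have mr := qb_meas qE (Er n).
rewrite /Y ecalderon_scale // gtr0_norm //.
have := @ecalderon_dilation R (rearr (y n)) (p n)^-1 t.
rewrite invrK mulrC; apply => //; first by rewrite invr_gt0.
by rewrite invf_le1 // /p ler1n expn_gt0.
Qed.

(** Off a set of measure [t] each term is at most its rearrangement at
    [t / 2 ^ k.+1], so the dominated function is at most the sum of these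
    values, which the previous lemma bounds. *)
Lemma majorant_dominated (R : realType) (E : set (R -> R))
    (NE : (R -> R) -> R) (C : R) :
  symmetric_quasi_banach E NE -> E `<=` @Lambda_log R -> 1 <= C ->
  (forall x y : R -> R, E x -> E y -> NE (x \+ y) <= C * (NE x + NE y)) ->
  forall (x y : nat -> R -> R) (w : R -> R) (e : R), 0 <= e ->
  (forall k, S0 (x k)) -> (forall k, majorant E (x k) (y k)) ->
  (forall k, NE (y k) <= e * (4 * C)^-1 ^+ k.+1) ->
  measurable_fun (@halfline R) w ->
  {ae @lebesgue_measure R, forall s, halfline s -> forall B : R,
    (forall n, \sum_(k < n) `|x k s| <= B) -> `|w s| <= B} ->
  S0 w /\ exists2 z, majorant E w z & NE z <= C * e.
Proof.
move=> hE hlog C1 hC x y w e e0 Sx xy Ny mw wB.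
have [z [Ez Nz zge]] := majorant_series hE hlog C1 hC e0 Sx xy Ny.
have Lz := hlog _ Ez.
have dB t : 0 < t ->
    (distrib w (fine (ecalderon (rearr z) t)) <= t%:E)%E.
  move=> t0; apply: le_trans (measure_series_level Sx t0).
  have finz : ecalderon (rearr z) t \is a fin_num.
    by rewrite ge0_fin_numE ?ecalderon_ge0 // ecalderon_Lambda_log.
  apply: le_measure_ae; first exact: measurable_level.
    by apply: bigcup_measurable => k _; apply: measurable_level; case: (Sx k).
  apply: filterS wB => s ws [Hs /= Bs]; apply: contrapT => nb.
  have {}nb k : `|x k s| <= rearr (x k) (t / (2 ^ k.+1)%:R).
    by rewrite leNgt; apply/negP => h; apply: nb; exists k.
  move: Bs; apply/negP; rewrite -leNgt; apply: ws => // n.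
  rewrite -lee_fin (fineK finz); apply: le_trans (zge n t t0).
  by rewrite lee_fin; apply: ler_sum.
split.
  split => //; exists (fine (ecalderon (rearr z) 1) + 1).
    by rewrite ltr_wpDl // fine_ge0 // ecalderon_ge0.
  apply: le_lt_trans (ltry 1); apply: le_trans (dB 1 ltr01).
  by apply: distrib_nincr => //; rewrite lerDl.
exists z; [apply/(majorantE _ _ hlog)|exact: Nz]; split; [exact: Ez|move=> t t0].
have finz : ecalderon (rearr z) t \is a fin_num.
  by rewrite ge0_fin_numE ?ecalderon_ge0 // ecalderon_Lambda_log.
rewrite -(fineK finz) lee_fin; apply: rearr_le; last exact: dB.
by rewrite fine_ge0 // ecalderon_ge0.
Qed.

Lemma bounded_normed_series_cvg (R : realType) (u : nat -> R) (B : R) :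
  (forall n, \sum_(k < n) `|u k| <= B) ->
  cvgn (fun n => \sum_(k < n) u k).
Proof.
move=> uB; rewrite (_ : (fun n => _) = series u); last first.
  by apply/funext => n; rewrite seriesEord.
apply: normed_cvg; apply: nondecreasing_is_cvgn.
  by apply: nondecreasing_series => n _ _ /=.
exists B => _ [n _ <-]; have := uB n.
by rewrite -(big_mkord xpredT (fun k => `|u k|)).
Qed.

(** The terms are absolutely summable off each exceptional set; these sets have
    arbitrarily small measure. *)
Lemma majorant_series_cvg (R : realType) (E : set (R -> R))
    (NE : (R -> R) -> R) (C : R) :
  symmetric_quasi_banach E NE -> E `<=` @Lambda_log R -> 1 <= C ->
  (forall x y : R -> R, E x -> E y -> NE (x \+ y) <= C * (NE x + NE y)) ->
  forall (x y : nat -> R -> R) (e : R), 0 <= e -> (forall k, S0 (x k)) ->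
  (forall k, majorant E (x k) (y k)) ->
  (forall k, NE (y k) <= e * (4 * C)^-1 ^+ k.+1) ->
  exists2 w : R -> R, measurable_fun (@halfline R) w &
    {ae @lebesgue_measure R, forall s, halfline s ->
      psum x n s @[n --> \oo] --> w s}.
Proof.
move=> hE hlog C1 hC x y e e0 Sx xy Ny.
have [z [Ez Nz zge]] := majorant_series hE hlog C1 hC e0 Sx xy Ny.
have Lz := hlog _ Ez.
have i0 m : 0 < m.+1%:R^-1 :> R by rewrite invr_gt0.
pose U m : set R := \bigcup_k (@halfline R `&`
  [set s | rearr (x k) (m.+1%:R^-1 / (2 ^ k.+1)%:R) < `|x k s|]).
have mU m : measurable (U m).
  by apply: bigcup_measurable => k _; apply: measurable_level; case: (Sx k).
pose N := \bigcap_m U m.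
have mN : measurable N.
  by apply: bigcap_measurable => [|m _]; [exists 0%N|exact: mU].
have N0 : @lebesgue_measure R N = 0%E.
  apply/eqP; rewrite -measure_le0; apply/lee_addgt0Pr => d d0; rewrite add0e.
  have [m] := ltr_add_invr d0; rewrite add0r => md.
  apply: (@le_trans _ _ (m.+1%:R^-1)%:E); last by rewrite lee_fin ltW.
  apply: le_trans (measure_series_level Sx (i0 m)).
  by apply: le_measure; rewrite ?inE //; [exact: mU|move=> s; exact].
pose x' k s := x k s * \1_(~` N) s.
have bound s : halfline s -> exists B, forall n, \sum_(k < n) `|x' k s| <= B.
  move=> Hs; have [Ns|nNs] := pselect (N s).
    exists 0 => n; rewrite big1 // => k _.
    by rewrite /x' indicE memNset ?mulr0 ?normr0 //; exact.
  have [m nU] : exists m, ~ U m s.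
    apply: contrapT => h; apply: nNs => m _; apply: contrapT => nU.
    by apply: h; exists m.
  exists (fine (ecalderon (rearr z) m.+1%:R^-1)) => n.
  have finz : ecalderon (rearr z) m.+1%:R^-1 \is a fin_num.
    by rewrite ge0_fin_numE ?ecalderon_ge0 // ecalderon_Lambda_log.
  rewrite -lee_fin (fineK finz); apply: le_trans (zge n _ (i0 m)).
  rewrite lee_fin; apply: ler_sum => k _.
  rewrite /x' indicE mem_set //= mulr1 leNgt; apply/negP => h.
  by apply: nU; exists k.
have cv s : halfline s -> psum x' n s @[n --> \oo] --> limn (psum x' ^~ s).
  by move=> /bound[B hB]; exact: (@bounded_normed_series_cvg _ (x' ^~ s) B hB).
exists (fun s => limn (psum x' ^~ s)).
  apply: (@measurable_fun_cvg _ _ _ _ (psum x')) => // n.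
  elim: n => [|n ih]; first by rewrite psum0; exact: measurable_cst.
  rewrite psumS; apply: measurable_funD => //; apply: measurable_funM.
    by case: (Sx n).
  by apply: measurable_funTS; apply: measurable_indic; exact: measurableC.
exists N; split => // s /= h; apply: contrapT => nNs; apply: h => Hs.
rewrite (_ : psum x ^~ s = psum x' ^~ s); first exact: cv.
apply/funext => n; apply: eq_bigr => k _.
by rewrite /x' indicE mem_set //= mulr1.
Qed.

Lemma psum_tail_bound (R : realType) (x : nat -> R -> R) (K : nat) (s l B : R) :
  psum x n s @[n --> \oo] --> l ->
  (forall n, \sum_(k < n) `|x (K + k)%N s| <= B) -> `|l - psum x K s| <= B.
Proof.
move=> xl hB; apply/ler_addgt0Pr => d d0.
move/cvgrPdist_lt : xl => /(_ d d0)[n0 _ /(_ (K + n0)%N)] /=.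
rewrite leq_addl => /(_ isT) h.
rewrite -(subrK (psum x (K + n0) s) l) -addrA addrC.
apply: le_trans (ler_normD _ _) _; apply: lerD; last exact: ltW.
rewrite -[X in `|X|]/((psum x (K + n0) \- psum x K) s) psumB.
exact: le_trans (ler_norm_sum _ _ _) (hB n0).
Qed.

(** * The range space *)

Lemma ecalderon_rearr_scale (R : realType) (a : R) (y : R -> R) (t : R) :
  S0 y -> 0 < t ->
  ecalderon (rearr (a \*o y)) t = (`|a|%:E * ecalderon (rearr y) t)%E.
Proof.
move=> Sy t0; rewrite -[`|a|]normr_id -ecalderon_scale //; last exact: measurable_rearr.
by apply: eq_integral => s; rewrite inE halflineE => s0; rewrite rearr_scaleE.
Qed.

Lemma majorant_scale (R : realType) (E : set (R -> R)) (NE : (R -> R) -> R)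
    (a : R) (x y : R -> R) :
  symmetric_quasi_banach E NE -> E `<=` @Lambda_log R -> S0 x ->
  majorant E x y -> majorant E (a \*o x) (a \*o y).
Proof.
move=> hE hlog Sx /(majorantE _ _ hlog)[Ey xy]; apply/(majorantE _ _ hlog); split.
  exact: (qb_scale (sqb_quasi_banach hE)).
move=> t t0; rewrite rearr_scaleE // ecalderon_rearr_scale //; last exact: (sqb_sub hE Ey).
by rewrite EFinM lee_wpmul2l ?lee_fin //; exact: xy.
Qed.

Lemma range_space_rearr (R : realType) (E : set (R -> R)) (NE : (R -> R) -> R)
    (x y : R -> R) :
  E `<=` @S0 R -> E `<=` @Lambda_log R -> range_space E x -> S0 y ->
  (forall t : R, 0 < t -> rearr y t = rearr x t) ->
  range_space E y /\ range_norm E NE y = range_norm E NE x.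
Proof.
move=> hS hlog /(range_spaceP _ hS hlog)[Sx [z xz]] Sy yx.
have maj : majorant E y = majorant E x.
  by apply/seteqP; split => v [Ev h]; split => // t t0; have := h t t0; rewrite yx.
split; last by rewrite /range_norm maj.
by apply/(range_spaceP _ hS hlog); split => //; exists z; rewrite maj.
Qed.

Lemma majorant0 (R : realType) (E : set (R -> R)) (NE : (R -> R) -> R) :
  symmetric_quasi_banach E NE -> E `<=` @Lambda_log R ->
  majorant E (cst 0) (cst 0).
Proof.
move=> hE hlog; apply/(majorantE _ _ hlog); split.
  exact: qb_0 (sqb_quasi_banach hE).
by move=> t t0; rewrite rearr0 // ecalderon_ge0.
Qed.

Lemma range_space_ideal (R : realType) (E : set (R -> R)) (NE : (R -> R) -> R)
    (x y : R -> R) :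
  symmetric_quasi_banach E NE -> E `<=` @Lambda_log R ->
  range_space E x -> S0 y ->
  {ae @lebesgue_measure R, forall t, halfline t -> `|y t| <= `|x t|} ->
  range_space E y /\ range_norm E NE y <= range_norm E NE x.
Proof.
move=> hE hlog Fx Sy yx; have hS := sqb_sub hE; have qE := sqb_quasi_banach hE.
have [Sx [z xz]] := (range_spaceP _ hS hlog).1 Fx.
have maj v : majorant E x v -> majorant E y v.
  move=> [Ev xv]; split => // t t0; apply: le_trans (xv t t0).
  by apply: rearr_mono => //; case: Sy.
split; first by apply/(range_spaceP _ hS hlog); split => //; exists z; exact: maj.
have ne : [set NE v | v in majorant E x] !=set0.
  by exists (NE z); exists z; [exact: xz|].
by apply: (lb_le_inf ne) => _ [v xv <-]; exact: range_norm_le qE (maj v xv).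
Qed.

Lemma range_normZ_le (R : realType) (E : set (R -> R)) (NE : (R -> R) -> R)
    (a : R) (x : R -> R) :
  symmetric_quasi_banach E NE -> E `<=` @Lambda_log R -> range_space E x ->
  range_space E (a \*o x) /\
  range_norm E NE (a \*o x) <= `|a| * range_norm E NE x.
Proof.
move=> hE hlog Fx; have hS := sqb_sub hE; have qE := sqb_quasi_banach hE.
have [Sx ex] := (range_spaceP _ hS hlog).1 Fx.
split.
  apply/(range_spaceP _ hS hlog); split; first exact: S0_scale.
  by have [y xy] := ex; exists (a \*o y); exact: majorant_scale hE hlog Sx xy.
apply/ler_addgt0Pr => d d0.
have a1 : 0 < `|a| + 1 by rewrite ltr_wpDl.
have [y xy Ny] : exists2 y, majorant E x y &
    NE y < range_norm E NE x + d / (`|a| + 1).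
  by apply: (range_norm_lt ex); rewrite ltrDl divr_gt0.
apply: le_trans (range_norm_le qE (majorant_scale a hE hlog Sx xy)) _.
have [Ey _] := xy; rewrite (qb_normZ qE) //.
apply: le_trans (ler_wpM2l (normr_ge0 a) (ltW Ny)) _.
rewrite mulrDr lerD2l mulrCA ler_piMr ?(ltW d0) //.
by rewrite ler_pdivrMr // mul1r lerDl.
Qed.

Lemma range_normZ (R : realType) (E : set (R -> R)) (NE : (R -> R) -> R)
    (a : R) (x : R -> R) :
  symmetric_quasi_banach E NE -> E `<=` @Lambda_log R -> range_space E x ->
  range_norm E NE (a \*o x) = `|a| * range_norm E NE x.
Proof.
move=> hE hlog Fx; have qE := sqb_quasi_banach hE.
have [Fax ax] := range_normZ_le a hE hlog Fx.
apply/eqP; rewrite eq_le ax /=.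
have [->|a0] := eqVneq a 0; first by rewrite normr0 mul0r range_norm_ge0.
have [_ h] := range_normZ_le a^-1 hE hlog Fax.
have ax1 : a^-1 \*o (a \*o x) = x by apply/funext => s /=; rewrite mulKf.
rewrite ax1 normfV in h.
by rewrite -ler_pdivlMl; [exact: h|rewrite normr_gt0].
Qed.

Lemma range_triangle (R : realType) (E : set (R -> R)) (NE : (R -> R) -> R)
    (C : R) :
  symmetric_quasi_banach E NE -> E `<=` @Lambda_log R -> 1 <= C ->
  (forall x y : R -> R, E x -> E y -> NE (x \+ y) <= C * (NE x + NE y)) ->
  forall x y : R -> R, range_space E x -> range_space E y ->
  range_space E (x \+ y) /\ range_norm E NE (x \+ y) <=
    2 * C * (range_norm E NE x + range_norm E NE y).
Proof.
move=> hE hlog C1 hC x y Fx Fy; have hS := sqb_sub hE.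
have qE := sqb_quasi_banach hE; have C0 : 0 < C by exact: lt_le_trans C1.
have [Sx ex] := (range_spaceP _ hS hlog).1 Fx.
have [Sy ey] := (range_spaceP _ hS hlog).1 Fy.
split.
  apply/(range_spaceP _ hS hlog); split; first exact: S0_add.
  have [u xu] := ex; have [v yv] := ey.
  by exists (2 \*o (rearr u \+ rearr v)); exact: majorant_add hE hlog Sx Sy xu yv.
apply/ler_addgt0Pr => d d0.
pose d' := d / (4 * C).
have d'0 : 0 < d' by rewrite divr_gt0 // mulr_gt0.
have [u xu Nu] : exists2 u, majorant E x u & NE u < range_norm E NE x + d'.
  by apply: (range_norm_lt ex); rewrite ltrDl.
have [v yv Nv] : exists2 v, majorant E y v & NE v < range_norm E NE y + d'.
  by apply: (range_norm_lt ey); rewrite ltrDl.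
apply: le_trans (range_norm_le qE (majorant_add hE hlog Sx Sy xu yv)) _.
have [Eu _] := xu; have [Ev _] := yv.
have [Eru NEu] := sqb_rearr hE Eu; have [Erv NEv] := sqb_rearr hE Ev.
rewrite (qb_normZ qE _ (qb_add qE Eru Erv)) (ger0_norm (ler0n R 2)).
have h := hC _ _ Eru Erv; rewrite NEu NEv in h.
have {}h := le_trans h (ler_wpM2l (ltW C0) (lerD (ltW Nu) (ltW Nv))).
apply: le_trans (ler_wpM2l (ler0n R 2) h) _.
rewrite le_eqVlt; apply/orP; left; apply/eqP; rewrite /d'; field.
by rewrite gt_eqF.
Qed.

(** Majorants of arbitrarily small norm have arbitrarily small logarithmic
    integrals, which control the operator at each [t]. *)
Lemma range_norm_eq0 (R : realType) (E : set (R -> R)) (NE : (R -> R) -> R)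
    (x : R -> R) :
  symmetric_quasi_banach E NE -> E `<=` @Lambda_log R -> range_space E x ->
  range_norm E NE x = 0 ->
  ae_eq (@lebesgue_measure R) (@halfline R) x (cst 0).
Proof.
move=> hE hlog Fx Nx; have hS := sqb_sub hE.
have [Sx ex] := (range_spaceP _ hS hlog).1 Fx; have [mx _] := Sx.
have rx t : 0 < t -> rearr x t <= 0.
  move=> t0; apply/ler_addgt0Pr => d d0; rewrite add0r.
  have c0 : 0 < 1 + t^-1 by rewrite addr_gt0 // invr_gt0.
  have [e e0 he] := sqb_logint_continuous hE hlog (divr_gt0 d0 c0).
  have [y xy Ny] : exists2 y, majorant E x y & NE y < e.
    by apply: (range_norm_lt ex); rewrite Nx.
  have [Ey xy'] := (majorantE _ _ hlog).1 xy.
  rewrite -lee_fin; apply: le_trans (xy' t t0) _.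
  apply: le_trans (ecalderon_logint (hS _ Ey) t0) _.
  apply: (@le_trans _ _ ((1 + t^-1)%:E * (d / (1 + t^-1))%:E)%E).
    by rewrite lee_wpmul2l ?lee_fin ?(ltW c0) //; exact: he.
  by rewrite -EFinM mulrCA divff ?gt_eqF // mulr1.
exists (@halfline R `&` [set s | 0 < `|x s|]); split.
- exact: measurable_level.
- apply/eqP; rewrite -measure_le0; apply/lee_addgt0Pr => t t0; rewrite add0e.
  by apply/(rearr_leP Sx (lexx 0) t0); exact: rx.
- move=> s /= h; apply: contrapT => nh; apply: h => Hs.
  apply/eqP; rewrite -normr_eq0 eq_le normr_ge0 andbT leNgt.
  by apply/negP => xs; apply: nh.
Qed.

(** A rapidly convergent subsequence has increments with summable majorants, so
    the series of increments converges almost everywhere and its tails are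
    majorized. *)
Lemma range_complete (R : realType) (E : set (R -> R)) (NE : (R -> R) -> R)
    (u : nat -> R -> R) :
  symmetric_quasi_banach E NE -> E `<=` @Lambda_log R ->
  (forall n, range_space E (u n)) ->
  (forall e : R, 0 < e -> exists n0 : nat, forall m n : nat,
    (n0 <= m)%N -> (n0 <= n)%N -> range_norm E NE (u m \- u n) < e) ->
  exists2 x, range_space E x &
    (fun n => range_norm E NE (u n \- x)) @ \oo --> (0 : R).
Proof.
move=> hE hlog Fu cau; have hS := sqb_sub hE; have qE := sqb_quasi_banach hE.
have [C C1 hC] := qb_triangle_ge1 qE.
have C0 : 0 < C by exact: lt_le_trans C1.
have tri := range_triangle hE hlog C1 hC.
have scl a (x : R -> R) : range_space E x -> range_space E (a \*o x).
  by move=> Fx; have [] := range_normZ_le a hE hlog Fx.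
have subE (x y : R -> R) : x \- y = x \+ (-1 \*o y).
  by apply/funext => s /=; rewrite mulN1r.
have Fsub (x y : R -> R) : range_space E x -> range_space E y ->
    range_space E (x \- y).
  by move=> Fx Fy; rewrite subE; have [] := tri _ _ Fx (scl (-1) _ Fy).
pose r := (4 * C)^-1.
have C40 : 0 < 4 * C by rewrite mulr_gt0.
have r0 : 0 < r by rewrite invr_gt0.
have r2 : r <= 2^-1.
  rewrite /r lef_pV2 ?posrE //.
  by apply: (le_trans _ (ler_peMr _ C1)) => //; rewrite ler_nat.
have /choice[n0 hn0] : forall k : nat, exists n0 : nat, forall m n : nat,
    (n0 <= m)%N -> (n0 <= n)%N -> range_norm E NE (u m \- u n) < r ^+ k.+1.
  by move=> k; apply: cau; rewrite exprn_gt0.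
(* Summing makes the chosen ranks nondecreasing. *)
pose phi k := (\sum_(i < k.+1) n0 i)%N.
have n0phi k : (n0 k <= phi k)%N by rewrite /phi big_ord_recr /= leq_addl.
have phiS k : (phi k <= phi k.+1)%N by rewrite /phi [in leqRHS]big_ord_recr /= leq_addr.
pose x k := u (phi k.+1) \- u (phi k).
have Fx k : range_space E (x k) by exact: Fsub.
have Sx k : S0 (x k) by have [] := (range_spaceP _ hS hlog).1 (Fx k).
have /choice[y hy] : forall k, exists y, majorant E (x k) y /\ NE y < r ^+ k.+1.
  move=> k; have [_ ex] := (range_spaceP _ hS hlog).1 (Fx k).
  have [|y xy Ny] := @range_norm_lt _ E NE (x k) (r ^+ k.+1) ex; last by exists y.
  by apply: hn0; [exact: leq_trans (phiS k)|].
have xy k : majorant E (x k) (y k) by case: (hy k).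
have Ny k : NE (y k) <= 1 * r ^+ k.+1 by rewrite mul1r ltW //; case: (hy k).
have [w mw cw] := majorant_series_cvg hE hlog C1 hC ler01 Sx xy Ny.
have psx n : psum x n = u (phi n) \- u (phi 0).
  elim: n => [|n ih]; apply/funext => s; first by rewrite psum0 /= subrr.
  by rewrite psumS ih /x /= addrC subrKA.
have mps n : measurable_fun (@halfline R) (psum x n).
  rewrite psx; have [[mu1 _] _] := (range_spaceP _ hS hlog).1 (Fu (phi n)).
  have [[mu0 _] _] := (range_spaceP _ hS hlog).1 (Fu (phi 0)).
  exact: measurable_funB.
have tail K : range_space E (w \- psum x K) /\
    range_norm E NE (w \- psum x K) <= C * r ^+ K.
  have rK0 : 0 <= r ^+ K by rewrite exprn_ge0 // ltW.
  have NyK k : NE (y (K + k)%N) <= r ^+ K * (4 * C)^-1 ^+ k.+1.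
    by rewrite -exprD addnS -[leRHS]mul1r; exact: Ny.
  have mwK : measurable_fun (@halfline R) (w \- psum x K) by exact: measurable_funB.
  have [|Sw [z wz Nz]] := majorant_dominated hE hlog C1 hC rK0
    (fun k => Sx (K + k)%N) (fun k => xy (K + k)%N) NyK mwK.
    apply: filterS cw => s + Hs B hB => /(_ Hs) ws.
    exact: psum_tail_bound ws hB.
  split; first by apply/(range_spaceP _ hS hlog); split => //; exists z.
  exact: le_trans (range_norm_le qE wz) Nz.
have Fw : range_space E w.
  have [+ _] := tail 0%N; rewrite psum0 (_ : w \- cst 0 = w) //.
  by apply/funext => s /=; rewrite subr0.
exists (u (phi 0) \+ w); first by have [] := tri _ _ (Fu (phi 0)) Fw.
apply/cvgrPdist_lt => d d0.
(* The bound of [tail] at [K] plus the Cauchy bound, through [tri]. *)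
have [K hK] := geometric_small (2 * C * (1 + C)) (ltW r0) r2 d0.
exists (phi K) => // n /= Kn.
rewrite sub0r normrN ger0_norm ?range_norm_ge0 //.
apply: le_lt_trans (hK K (leqnn K)).
have [FwK NwK] := tail K.
rewrite (_ : u n \- _ = (u n \- u (phi K)) \+ (-1 \*o (w \- psum x K))); last first.
  by apply/funext => s /=; rewrite psx /= mulN1r; ring.
have [_ h] := tri _ _ (Fsub _ _ (Fu n) (Fu (phi K))) (scl (-1) _ FwK).
apply: le_trans h _; rewrite -[leRHS]mulrA.
apply: ler_wpM2l; first by rewrite mulr_ge0 ?(ltW C0).
rewrite mulrDl mul1r range_normZ // normrN1 mul1r; apply: lerD => //.
have := hn0 K n (phi K) (leq_trans (n0phi K) Kn) (n0phi K).
move=> /ltW /le_trans; apply; rewrite exprS ler_piMl ?exprn_ge0 ?(ltW r0) //.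
by apply: le_trans r2 _; rewrite invf_le1 // ler1n.
Qed.

(** [S x] is dominated by [S (rearr x)], which is nonincreasing, hence at least
    its own rearrangement. *)
Lemma calderon_majorant (R : realType) (E : set (R -> R)) (NE : (R -> R) -> R)
    (x : R -> R) :
  symmetric_quasi_banach E NE -> E `<=` @Lambda_log R -> E x ->
  S0 (calderon x) /\ majorant E (calderon x) x.
Proof.
move=> hE hlog Ex; have Sx := sqb_sub hE Ex; have Lx := hlog _ Ex.
have [mx _] := Sx; have mr := measurable_rearr Sx.
have fin t : 0 < t -> (ecalderon x t < +oo)%E.
  move=> t0; apply: le_lt_trans (ecalderon_rearr t0 Sx) _.
  exact: ecalderon_Lambda_log.
pose g t := calderon (rearr x) t.
have gE t : 0 < t -> (g t)%:E = ecalderon (rearr x) t.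
  by move=> t0; exact: calderon_rearrE.
have g0 t : 0 < t -> 0 <= g t by move=> t0; rewrite -lee_fin gE ?ecalderon_ge0.
have ng t u : 0 < t -> t <= u -> g u <= g t.
  move=> t0 tu; have u0 := lt_le_trans t0 tu; rewrite -lee_fin !gE //.
  exact: ecalderon_nincr.
have Sg : S0 g by exact: S0_nincr.
have mc : measurable_fun (@halfline R) (calderon x) by exact: measurable_calderon.
have cg : {ae @lebesgue_measure R, forall t, halfline t ->
    `|calderon x t| <= `|g t|}.
  apply: aeW => t; rewrite halflineE => t0; rewrite (ger0_norm (g0 t t0)).
  rewrite -lee_fin gE //; apply: le_trans (calderon_abs_le t0 mx (fin t t0)) _.
  exact: ecalderon_rearr.
split; first exact: S0_le mc Sg cg.
split => // t t0; apply: le_trans (rearr_mono mc Sg t0 cg) _.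
by apply: rearr_le; [exact: g0|exact: distrib_nincr_fun].
Qed.

Lemma range_quasi_banach (R : realType) (E : set (R -> R))
    (NE : (R -> R) -> R) :
  symmetric_quasi_banach E NE -> E `<=` @Lambda_log R ->
  quasi_banach (range_space E) (range_norm E NE).
Proof.
move=> hE hlog; have hS := sqb_sub hE; have qE := sqb_quasi_banach hE.
have [C C1 hC] := qb_triangle_ge1 qE.
have tri := range_triangle hE hlog C1 hC.
have F0 : range_space E (cst 0).
  apply/(range_spaceP _ hS hlog); split; first exact: hS _ (qb_0 qE).
  by exists (cst 0); exact: majorant0 hE hlog.
have N0 : range_norm E NE (cst 0) = 0.
  rewrite (_ : cst 0 = 0 \*o cst 0) ?range_normZ ?normr0 ?mul0r //.
  by apply/funext => s /=; rewrite mul0r.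
have Fae x y : range_space E x -> measurable_fun (@halfline R) y ->
    ae_eq (@lebesgue_measure R) (@halfline R) y x ->
    range_space E y /\ range_norm E NE y = range_norm E NE x.
  move=> Fx my yx; have [Sx _] := (range_spaceP _ hS hlog).1 Fx.
  have le1 : {ae @lebesgue_measure R, forall t, halfline t -> `|y t| <= `|x t|}.
    by apply: filterS yx => t + Ht => /(_ Ht) ->.
  have le2 : {ae @lebesgue_measure R, forall t, halfline t -> `|x t| <= `|y t|}.
    by apply: filterS yx => t + Ht => /(_ Ht) ->.
  have [mx _] := Sx.
  apply: range_space_rearr => //; first exact: S0_le my Sx le1.
  move=> t _; apply: eq_rearr => s _; apply/eqP; rewrite eq_le.
  by rewrite !distrib_le.
split => //.
- by move=> x /(range_spaceP _ hS hlog)[[]].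
- by move=> x y Fx Fy; have [] := tri x y Fx Fy.
- by move=> a x Fx; have [] := range_normZ_le a hE hlog Fx.
- by move=> x _; exact: range_norm_ge0.
- move=> x Fx; split; first exact: range_norm_eq0.
  move=> x0; have [[mx _] _] := (range_spaceP _ hS hlog).1 Fx.
  by have [_ ->] := Fae (cst 0) x F0 mx x0.
- by move=> a x Fx; exact: range_normZ.
- by exists (2 * C) => x y Fx Fy; have [] := tri x y Fx Fy.
- by move=> v; exact: range_complete.
Qed.

Theorem theorem26 (R : realType) (E : set (R -> R)) (NE : (R -> R) -> R)
    (hE : symmetric_quasi_banach E NE) (hElog : E `<=` @Lambda_log R) :
  quasi_banach (range_space E) (range_norm E NE) /\
  [/\ symmetric_quasi_banach (range_space E) (range_norm E NE),
      bounded_operator (@calderon R) E NE (range_space E) (range_norm E NE) &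
      forall (G : set (R -> R)) (NG : (R -> R) -> R),
        symmetric_quasi_banach G NG ->
        bounded_operator (@calderon R) E NE G NG ->
        range_space E `<=` G].
Proof.
have hS := sqb_sub hE; have qE := sqb_quasi_banach hE.
have qF := range_quasi_banach hE hElog.
split => //; split.
- split => //.
  + by move=> x /(range_spaceP _ hS hElog)[].
  + by move=> x y; exact: range_space_ideal.
  + by move=> x y; exact: range_space_rearr.
- split=> [x Ex|]; first by have [Sc maj] := calderon_majorant hE hElog Ex;
    apply/(range_spaceP _ hS hElog); split => //; exists x.
  exists 1 => x Ex; rewrite mul1r; apply: range_norm_le => //.
  by have [] := calderon_majorant hE hElog Ex.
- move=> G NG hG [SG _] x /(range_spaceP _ hS hElog)[Sx [y [Ey xy]]].
  have [Ery _] := sqb_rearr hE Ey.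
  have Srx := S0_rearr Sx.
  have [Grx _] : G (rearr x) /\ NG (rearr x) <= NG (calderon (rearr y)).
    apply: (sqb_ideal hG) => //; first exact: SG.
    apply: aeW => t; rewrite halflineE => t0.
    rewrite ger0_norm ?rearr_ge0 // (le_trans _ (ler_norm _)) //; exact: xy.
  have [] // := sqb_symm hG Grx Sx.
  by move=> t _; rewrite rearr_idem.
Qed.
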